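(* Let $n\ge1$. If $H$ is a self-scaled barrier functional for the cone of symmetric positive semidefinite real $n\times n$ matrices (so $H$ is defined on the open cone $\Omega$ of symmetric positive definite real $n\times n$ matrices), then there exist constants $c_1>0$ and $c_0\in\mathbb{R}$ such that $$H(X)=c_0-c_1\ln\det(X)\qquad\text{for all }X\in\Omega.$$
   Context: $V$ is the space of real symmetric $n\times n$ matrices with the trace inner product $\langle X,S\rangle=\operatorname{tr}(XS)$, and $\Omega\subset V$ is the open cone of positive definite matrices. **Self-scaled barriers.** Let $\Omega^\sharp=\{S\in V:\langle X,S\rangle>0\ \forall X\in\Omega\}$ (the definition in the paper follows the Nesterov–Todd convention; here $\Omega^\sharp=\Omega$). For a function $H$ on $\Omega$, the Hessian $H''(X):V\to V$ is the self-adjoint linear map with $D^2H(X)[A,B]=\langle H''(X)A,B\rangle$. A $\nu$-self-concordant logarithmically homogeneous barrier functional for $\Omega$ is a convex function $H\in C^3(\Omega,\mathbb{R})$ such that: $|D^3H(X)[A,A,A]|\le 2\,(D^2H(X)[A,A])^{3/2}$ for all $X\in\Omega$, $A\in V$; $H(X_k)\to+\infty$ whenever $X_k\in\Omega$ converges to a boundary point of $\Omega$; $H''(X)$ is non-singular for all $X\in\Omega$; and $H(tX)=H(X)-\nu\ln t$ for all $X\in\Omega$, $t>0$ (in particular $\langle H'(X),H''(X)^{-1}H'(X)\rangle\le\nu$). Such an $H$ is called self-scaled if (a) $H''(W)X\in\Omega^\sharp$ for all $X,W\in\Omega$, and (b) $H_\sharp\bigl(H''(W)X\bigr)=H(X)-2H(W)-\nu$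 for all $X,W\in\Omega$, where $H_\sharp(S)=\max\{-\langle X,S\rangle-H(X):X\in\Omega\}$ for $S\in\Omega^\sharp$. A self-scaled barrier functional for the cone is such an $H$ for some parameter $\nu$. *)

(* Defs.v *)
(* MathComp-Analysis *)
From HB Require Import structures.
From mathcomp Require Import all_boot all_order all_algebra.
From mathcomp Require Import all_classical all_reals all_analysis.

Set Implicit Arguments.
Unset Strict Implicit.
Unset Printing Implicit Defensive.

Import Order.TTheory GRing.Theory Num.Theory.
Import numFieldNormedType.Exports.

Local Open Scope classical_set_scope.
Local Open Scope ring_scope.

(* A real function on the cone is represented by a total function on           *)
(* 'M[R]_n. Only its values on the cone matter: the cone is open in the space  *)
(* of symmetric matrices, and every derivative below is taken at a point of    *)
(* the cone along symmetric directions.                                        *)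

Definition symm (R : realType) (n : nat) : set 'M[R]_n :=
  [set A | A \is symmetricmx].

Definition trdot (R : realType) (n : nat) (X S : 'M[R]_n) : R :=
  \tr (X *m S).

Definition posdef (R : realType) (n : nat) : set 'M[R]_n :=
  [set X | symm X /\ forall u : 'cV[R]_n, u != 0 -> 0 < (u^T *m X *m u) 0 0].

(* Taken literally, this is the set of nonzero positive semidefinite matrices, *)
(* whose interior in [symm] is [posdef]. In condition (a) of [self_scaled]     *)
(* both sets give the same requirement: the non-singular map H''(W) sends the  *)
(* open cone onto an open subset of [symm].                                    *)
Definition dual_cone (R : realType) (n : nat) : set 'M[R]_n :=
  [set S | symm S /\ forall X : 'M[R]_n, posdef X -> 0 < trdot X S].

(* [posdef] is open in [symm] and [symm] is closed in 'M[R]_n, so this is the  *)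
(* boundary of the cone relative to [symm].                                    *)
Definition cone_boundary (R : realType) (n : nat) : set 'M[R]_n :=
  closure (@posdef R n) `\` @posdef R n.

(* Class C^k on the cone, as an open subset of the finite-dimensional space of *)
(* symmetric matrices: all iterated directional derivatives of order at most k *)
(* along symmetric matrices exist and are continuous on the cone.              *)
Fixpoint class_C (R : realType) (n k : nat) (f : 'M[R]_n -> R) : Prop :=
  {within @posdef R n, continuous f} /\
  if k is k'.+1 then
    forall A : 'M[R]_n, symm A ->
      (forall X : 'M[R]_n, posdef X -> derivable f X A) /\ class_C k' ('D_A f)
  else True.

Definition D2 (R : realType) (n : nat) (H : 'M[R]_n -> R)
    (X A B : 'M[R]_n) : R :=
  'D_A ('D_B H) X.

Definition D3 (R : realType) (n : nat) (H : 'M[R]_n -> R)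
    (X A B C : 'M[R]_n) : R :=
  'D_A ('D_B ('D_C H)) X.

(* H''(X) A: the symmetric matrix that represents the linear form              *)
(* B |-> D^2 H(X)[A, B] for the trace inner product. It is unique, and exists  *)
(* when H is of class C^2.                                                     *)
Definition hessian (R : realType) (n : nat) (H : 'M[R]_n -> R)
    (X A : 'M[R]_n) : 'M[R]_n :=
  get [set S | symm S /\
    forall B : 'M[R]_n, symm B -> D2 H X A B = trdot S B].

Record sc_log_homogeneous_barrier (R : realType) (n : nat) (nu : R)
    (H : 'M[R]_n -> R) : Prop := {
  barrier_convex : convex_function (@posdef R n) H;
  barrier_C3 : class_C 3 H;
  barrier_self_concordant :
    forall X A : 'M[R]_n, posdef X -> symm A ->
      `|D3 H X A A A| <= 2 * (D2 H X A A) `^ (3 / 2);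
  barrier_boundary :
    forall (X : nat -> 'M[R]_n) (Y : 'M[R]_n),
      (forall k, posdef (X k)) -> cone_boundary Y -> X k @[k --> \oo] --> Y ->
      H (X k) @[k --> \oo] --> +oo;
  barrier_nonsingular :
    forall X : 'M[R]_n, posdef X ->
      set_bij (@symm R n) (@symm R n) (hessian H X);
  barrier_log_homogeneous :
    forall (X : 'M[R]_n) (t : R), posdef X -> 0 < t ->
      H (t *: X) = H X - nu * ln t
}.

Definition is_max (R : realType) (E : set R) (m : R) : Prop :=
  E m /\ ubound E m.

(* H_sharp(S) = v, the value of the maximum being part of the definition of    *)
(* H_sharp.                                                                    *)
Definition conjugate_eq (R : realType) (n : nat) (H : 'M[R]_n -> R)
    (S : 'M[R]_n) (v : R) : Prop :=
  is_max [set - trdot X S - H X | X in @posdef R n] v.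

Record self_scaled (R : realType) (n : nat) (nu : R) (H : 'M[R]_n -> R)
    : Prop := {
  self_scaled_barrier : sc_log_homogeneous_barrier nu H;
  self_scaled_dual :
    forall X W : 'M[R]_n, posdef X -> posdef W -> dual_cone (hessian H W X);
  self_scaled_conjugate :
    forall X W : 'M[R]_n, posdef X -> posdef W ->
      conjugate_eq H (hessian H W X) (H X - 2 * H W - nu)
}.

Definition self_scaled_barrier_functional (R : realType) (n : nat)
    (H : 'M[R]_n -> R) : Prop :=
  exists nu : R, self_scaled nu H.

(* Main.v *)
Require Import Defs.
From mathcomp Require Import all_boot all_order all_algebra.
From mathcomp Require Import all_classical all_reals all_analysis.
From mathcomp Require Import ring lra.
Local Open Scope ring_scope.

Set Implicit Arguments.
Unset Strict Implicit.
Unset Printing Implicit Defensive.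

Import Order.TTheory GRing.Theory Num.Theory.
Import numFieldNormedType.Exports.

(* For W in the cone write q = H''(W) and S = q W = - H'(W). The barrier       *)
(* property and (b) imply that q is a self-adjoint linear automorphism of the  *)
(* cone. Comparing the largest t such that X - t u u^T stays in the cone with  *)
(* its image under q gives q ((q X)^-1) = X^-1, and Hua's identity turns this  *)
(* into q (X (q V) X) = (q X) V (q X). Differentiating the latter in W at      *)
(* X = W, and using that D^3 H is totally symmetric with D^3 H(W)[W, A, B] =   *)
(* - 2 D^2 H(W)[A, B], determines D^3 H(W) by a Koszul-type computation:       *)
(*   D^3 H(W)[A, B, C] = - tr ((qA S^-1 qB + qB S^-1 qA) C).                   *)
(* The total symmetry of the right-hand side forces S W to be scalar, and      *)
(* homogeneity makes the scalar nu / n. Thus H'(W) = - (nu / n) W^-1, which is *)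
(* the gradient of - (nu / n) ln det.                                          *)

(** * Quadratic forms and positive definite matrices *)

(** A self-scaled barrier turns each Hessian [q = hessian H W] into a symmetry of the cone, and such
    symmetries are rigid enough to pin down [H]. By (b), [H X] is up to constants the conjugate of
    [H] at [q X], so it cannot increase when [q X] grows ([self_scaled_monotone]). As [H] blows up
    at the boundary, [q] cannot carry a boundary point into the interior, whence [q] preserves the
    cone in both directions ([hessian_cone_aut]). Order and duality alone make such a [q] compatible
    with inversion ([cone_aut_invmx]), hence with the quadratic maps ([cone_aut_quad]). That
    identity holds for every [W] and may be differentiated in [W] ([D3_cone_quad]). With Euler's
    relations and the symmetry of the third derivative it fixes [D3 H W] ([cone_aut_third_form]) and
    forces [q W] to be a multiple of [W^-1] ([cone_aut_third_form_scalar]). So [H] and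
    [- (nu / n) ln det] have the same gradient ([grad_scalar], [is_derive_ln_det]), and they differ
    by a constant because the cone is convex. *)

Definition qform (R : realType) (n : nat) (X : 'M[R]_n) (u : 'cV[R]_n) : R :=
  (u^T *m X *m u) 0 0.

Definition psd (R : realType) (n : nat) (X : 'M[R]_n) : Prop :=
  symm X /\ forall u, 0 <= qform X u.

Lemma symmP (R : realType) (n : nat) (A : 'M[R]_n) : symm A <-> A^T = A.
Proof.
rewrite /symm /=; split=> [/is_hermitianmxP h|h].
  by rewrite [RHS]h expr0 scale1r map_mx_id.
by apply/is_hermitianmxP; rewrite expr0 scale1r map_mx_id ?h.
Qed.

Lemma symm_tr (R : realType) (n : nat) (A : 'M[R]_n) : symm A -> A^T = A.
Proof. by move/symmP. Qed.

Lemma symmD (R : realType) (n : nat) (A B : 'M[R]_n) :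
  symm A -> symm B -> symm (A + B).
Proof. by move=> /symmP a /symmP b; apply/symmP; rewrite linearD /= a b. Qed.

Lemma symmZ (R : realType) (n : nat) (c : R) (A : 'M[R]_n) :
  symm A -> symm (c *: A).
Proof. by move=> /symmP a; apply/symmP; rewrite linearZ /= a. Qed.

Lemma symmB (R : realType) (n : nat) (A B : 'M[R]_n) :
  symm A -> symm B -> symm (A - B).
Proof. by move=> a b; rewrite -scaleN1r; apply/symmD/symmZ. Qed.

Lemma symm0 (R : realType) (n : nat) : symm (0 : 'M[R]_n).
Proof. by apply/symmP; rewrite trmx0. Qed.

Lemma symm1 (R : realType) (n : nat) : symm (1%:M : 'M[R]_n).
Proof. by apply/symmP; rewrite trmx1. Qed.

Lemma symm_inv (R : realType) (n : nat) (A : 'M[R]_n) :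
  symm A -> symm (invmx A).
Proof. by move=> /symmP a; apply/symmP; rewrite trmx_inv a. Qed.

Lemma symm_conj (R : realType) (n : nat) (A B : 'M[R]_n) :
  symm A -> symm B -> symm (A *m B *m A).
Proof.
by move=> /symmP a /symmP b; apply/symmP; rewrite !trmx_mul a b mulmxA.
Qed.

Lemma symm_anti (R : realType) (n : nat) (A B C : 'M[R]_n) :
  symm A -> symm B -> symm C -> symm (A *m B *m C + C *m B *m A).
Proof.
move=> /symmP a /symmP b /symmP c; apply/symmP.
by rewrite linearD /= !trmx_mul a b c !mulmxA addrC.
Qed.

Lemma symm_rank1 (R : realType) (n : nat) (u : 'cV[R]_n) : symm (u *m u^T).
Proof. by apply/symmP; rewrite trmx_mul trmxK. Qed.

Lemma qform_row (R : realType) (n : nat) (X : 'M[R]_n) (u v : 'cV[R]_n) :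
  symm X -> (u^T *m X *m v) 0 0 = (v^T *m X *m u) 0 0.
Proof.
move=> /symmP x; have -> : v^T *m X *m u = (u^T *m X *m v)^T.
  by rewrite !trmx_mul x trmxK mulmxA.
by rewrite [RHS]mxE.
Qed.

Lemma qformD (R : realType) (n : nat) (X Y : 'M[R]_n) u :
  qform (X + Y) u = qform X u + qform Y u.
Proof. by rewrite /qform mulmxDr mulmxDl mxE. Qed.

Lemma qformZ (R : realType) (n : nat) c (X : 'M[R]_n) u :
  qform (c *: X) u = c * qform X u.
Proof. by rewrite /qform -scalemxAr -scalemxAl mxE. Qed.

Lemma qformB (R : realType) (n : nat) (X Y : 'M[R]_n) u :
  qform (X - Y) u = qform X u - qform Y u.
Proof. by rewrite qformD -scaleN1r qformZ mulN1r. Qed.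

Lemma qform0 (R : realType) (n : nat) (X : 'M[R]_n) : qform X 0 = 0.
Proof. by rewrite /qform mulmx0 mxE. Qed.

Lemma qform1 (R : realType) (n : nat) (u : 'cV[R]_n) :
  qform 1%:M u = \sum_i (u i 0) ^+ 2.
Proof.
rewrite /qform mulmx1 mxE; apply: eq_bigr => i _.
by rewrite mxE expr2.
Qed.

Lemma qform1_gt0 (R : realType) (n : nat) (u : 'cV[R]_n) :
  u != 0 -> 0 < qform 1%:M u.
Proof.
move=> u0; rewrite qform1 lt0r sumr_ge0 ?andbT; last first.
  by move=> i _; rewrite sqr_ge0.
apply: contra u0 => /eqP h; apply/eqP/colP => i; rewrite mxE.
have := psumr_eq0P (fun i _ => sqr_ge0 (u i 0)) h.
by move=> /(_ i erefl) /eqP; rewrite sqrf_eq0 => /eqP.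
Qed.

Lemma qform_rank1 (R : realType) (n : nat) (u v : 'cV[R]_n) :
  qform (u *m u^T) v = ((v^T *m u) 0 0) ^+ 2.
Proof.
rewrite /qform mulmxA -mulmxA mxE big_ord1 expr2; congr (_ * _).
have -> : u^T *m v = (v^T *m u)^T by rewrite trmx_mul trmxK.
by rewrite mxE.
Qed.

Lemma qform_sub (R : realType) (n : nat) (X : 'M[R]_n) u v (t : R) :
  symm X ->
  qform X (u - t *: v) =
  qform X u - 2 * t * (v^T *m X *m u) 0 0 + t ^+ 2 * qform X v.
Proof.
move=> sX; rewrite /qform.
have -> : (u - t *: v)^T = u^T - t *: v^T by rewrite linearB linearZ.
have EB (A B : 'M[R]_1) : (A - B) 0 0 = A 0 0 - B 0 0 by rewrite !mxE.
have EZ c (A : 'M[R]_1) : (c *: A) 0 0 = c * A 0 0 by rewrite !mxE.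
rewrite mulmxBr !mulmxBl -!scalemxAr -!scalemxAl !(EB, EZ).
rewrite (qform_row u v sX) /qform; ring.
Qed.

Lemma posdef_psd (R : realType) (n : nat) (X : 'M[R]_n) : posdef X -> psd X.
Proof.
move=> [sX pX]; split=> // u; have [->|u0] := eqVneq u 0.
  by rewrite qform0.
by rewrite ltW // pX.
Qed.

Lemma posdef_gt0 (R : realType) (n : nat) (X : 'M[R]_n) u :
  posdef X -> u != 0 -> 0 < qform X u.
Proof. by move=> [_]; apply. Qed.

Lemma posdef1 (R : realType) (n : nat) : posdef (1%:M : 'M[R]_n).
Proof. by split; [exact: symm1 | move=> u; exact: qform1_gt0]. Qed.

Lemma posdefD (R : realType) (n : nat) (X Y : 'M[R]_n) :
  posdef X -> psd Y -> posdef (X + Y).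
Proof.
move=> pX [sY pY]; split; first by apply: symmD => //; case: pX.
by move=> u u0; rewrite -/(qform _ u) qformD ltr_pwDl // posdef_gt0.
Qed.

Lemma posdefZ (R : realType) (n : nat) (c : R) (X : 'M[R]_n) :
  0 < c -> posdef X -> posdef (c *: X).
Proof.
move=> c0 pX; split; first by apply: symmZ; case: pX.
by move=> u u0; rewrite -/(qform _ u) qformZ mulr_gt0 // posdef_gt0.
Qed.

Lemma psdZ (R : realType) (n : nat) (c : R) (X : 'M[R]_n) :
  0 <= c -> psd X -> psd (c *: X).
Proof.
move=> c0 [sX pX]; split; first exact: symmZ.
by move=> u; rewrite qformZ mulr_ge0.
Qed.

Lemma psd_rank1 (R : realType) (n : nat) (u : 'cV[R]_n) : psd (u *m u^T).
Proof.
by split; [exact: symm_rank1 | move=> v; rewrite qform_rank1 sqr_ge0].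
Qed.

Lemma posdef_unit (R : realType) (n : nat) (X : 'M[R]_n) :
  posdef X -> X \in unitmx.
Proof.
move=> pX; rewrite -row_free_unit -kermx_eq0; apply/negPn/negP => /rowV0Pn[v].
move=> /sub_kermxP vX v0.
have : 0 < qform X v^T by apply: posdef_gt0 => //; rewrite trmx_eq0.
by rewrite /qform trmxK vX mul0mx mxE ltxx.
Qed.

Lemma posdef_inv (R : realType) (n : nat) (X : 'M[R]_n) :
  posdef X -> posdef (invmx X).
Proof.
move=> pX; have uX := posdef_unit pX; have sX := proj1 pX.
split; first exact: symm_inv.
move=> u u0; have := @posdef_gt0 _ _ X (invmx X *m u) pX.
rewrite /qform trmx_mul (symm_tr (symm_inv sX)) -!mulmxA (mulmxA X).
rewrite mulmxV // mul1mx; apply.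
apply: contra u0 => /eqP h.
by rewrite -(mul1mx u) -(mulmxV uX) -mulmxA h mulmx0.
Qed.

Lemma psd_cauchy_schwarz (R : realType) (n : nat) (X : 'M[R]_n) u v :
  psd X -> ((v^T *m X *m u) 0 0) ^+ 2 <= qform X u * qform X v.
Proof.
move=> [sX pX]; set b := (_ *m u) 0 0.
have a0 := pX u; have c0 := pX v.
have h t : 0 <= qform X u - 2 * t * b + t ^+ 2 * qform X v.
  by rewrite -(qform_sub _ _ _ sX) pX.
have [c1|c1] := eqVneq (qform X v) 0; last first.
  have c2 : 0 < qform X v by rewrite lt0r c1 c0.
  have := h (b / qform X v).
  have -> : qform X u - 2 * (b / qform X v) * b +
      (b / qform X v) ^+ 2 * qform X v =
      (qform X u * qform X v - b ^+ 2) / qform X v by field.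
  by rewrite pmulr_lge0 ?invr_gt0 // subr_ge0.
rewrite c1 mulr0; have [->|b0] := eqVneq b 0; first by rewrite expr0n.
(* The bound is now affine in [t], and this [t] brings it down to [- qform X u - 2], which is
   negative. *)
have := h ((qform X u + 1) / b); rewrite c1 mulr0 addr0.
have -> : qform X u - 2 * ((qform X u + 1) / b) * b = - qform X u - 2 by field.
lra.
Qed.

(** Cauchy-Schwarz for [X] at the vectors [u] and [X^-1 v]. *)
Lemma posdef_cauchy_schwarz (R : realType) (n : nat) (X : 'M[R]_n) u v :
  posdef X -> ((v^T *m u) 0 0) ^+ 2 <= qform (invmx X) v * qform X u.
Proof.
move=> pX; have uX := posdef_unit pX; have sX := proj1 pX.
have := psd_cauchy_schwarz u (invmx X *m v) (posdef_psd pX).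
rewrite /qform !trmx_mul (symm_tr (symm_inv sX)) -!mulmxA (mulmxA X (invmx X)).
rewrite (mulmxA (invmx X) X) mulVmx // mulmxV // !mul1mx.
by rewrite mulrC.
Qed.

Lemma bform_delta (R : realType) (n : nat) (X : 'M[R]_n) i j :
  ((delta_mx i 0 : 'cV_n)^T *m X *m (delta_mx j 0 : 'cV_n)) 0 0 = X i j.
Proof. by rewrite trmx_delta -rowE -colE !mxE. Qed.

Lemma qform_delta (R : realType) (n : nat) (X : 'M[R]_n) i :
  qform X (delta_mx i 0) = X i i.
Proof. exact: bform_delta. Qed.

Lemma delta_coord (R : realType) (n : nat) (u : 'cV[R]_n) i :
  ((delta_mx i 0 : 'cV_n)^T *m u) 0 0 = u i 0.
Proof. by rewrite trmx_delta -rowE mxE. Qed.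

Lemma posdef_diag_gt0 (R : realType) (n : nat) (X : 'M[R]_n) i :
  posdef X -> 0 < X i i.
Proof.
move=> pX; rewrite -qform_delta; apply: posdef_gt0 => //.
by apply/eqP => /colP /(_ i) /eqP; rewrite !mxE !eqxx oner_eq0.
Qed.

Lemma psd_diag_ge0 (R : realType) (n : nat) (X : 'M[R]_n) i :
  psd X -> 0 <= X i i.
Proof. by move=> [_ pX]; rewrite -qform_delta. Qed.

Lemma qform_eq0 (R : realType) (n : nat) (A : 'M[R]_n) :
  symm A -> (forall u, qform A u = 0) -> A = 0.
Proof.
move=> sA h; apply/matrixP => i j; rewrite [RHS]mxE -bform_delta.
have := qform_sub (delta_mx j 0) (delta_mx i 0) 1 sA; rewrite !h.
lra.
Qed.

(** * The trace inner product and its positivity on the cone *)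

Lemma trdotC (R : realType) (n : nat) (A B : 'M[R]_n) : trdot A B = trdot B A.
Proof. by rewrite /trdot mxtrace_mulC. Qed.

Lemma trdotDl (R : realType) (n : nat) (A B C : 'M[R]_n) :
  trdot (A + B) C = trdot A C + trdot B C.
Proof. by rewrite /trdot mulmxDl linearD. Qed.

Lemma trdotZl (R : realType) (n : nat) c (A B : 'M[R]_n) :
  trdot (c *: A) B = c * trdot A B.
Proof. by rewrite /trdot -scalemxAl linearZ. Qed.

Lemma trdotDr (R : realType) (n : nat) (A B C : 'M[R]_n) :
  trdot A (B + C) = trdot A B + trdot A C.
Proof. by rewrite /trdot mulmxDr linearD. Qed.

Lemma trdotZr (R : realType) (n : nat) c (A B : 'M[R]_n) :
  trdot A (c *: B) = c * trdot A B.
Proof. by rewrite /trdot -scalemxAr linearZ. Qed.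

Lemma trdotBl (R : realType) (n : nat) (A B C : 'M[R]_n) :
  trdot (A - B) C = trdot A C - trdot B C.
Proof. by rewrite trdotDl -scaleN1r trdotZl mulN1r. Qed.

Lemma trdotBr (R : realType) (n : nat) (A B C : 'M[R]_n) :
  trdot A (B - C) = trdot A B - trdot A C.
Proof. by rewrite trdotDr -scaleN1r trdotZr mulN1r. Qed.

Lemma trdot_rank1 (R : realType) (n : nat) (X : 'M[R]_n) u :
  trdot X (u *m u^T) = qform X u.
Proof.
by rewrite /trdot mulmxA mxtrace_mulC mulmxA /qform /mxtrace big_ord1.
Qed.

Lemma trdot_inj (R : realType) (n : nat) (A B : 'M[R]_n) :
  symm A -> symm B ->
  (forall C, symm C -> trdot A C = trdot B C) -> A = B.
Proof.
move=> sA sB h; apply/eqP; rewrite -subr_eq0; apply/eqP.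
apply: qform_eq0 => [|u]; first exact: symmB.
by rewrite -trdot_rank1 trdotBl h ?subrr //; exact: symm_rank1.
Qed.

(* A nonzero diagonal entry [S i i] of a positive semidefinite [S] is cleared  *)
(* by subtracting [(S e_i) (S e_i)^T / S i i], which keeps [S] positive        *)
(* semidefinite by Cauchy-Schwarz.                                             *)
Lemma trdot_psd_ge0 (R : realType) (n : nat) (Z S : 'M[R]_n) :
  psd Z -> psd S -> 0 <= trdot Z S.
Proof.
move=> pZ; have [k] := ubnP #|[pred i | S i i != 0]|.
elim: k S => // k IH S; rewrite ltnS => leS pS.
have [i /= Si|S0] := pickP [pred i | S i i != 0]; last first.
  suff -> : S = 0 by rewrite /trdot mulmx0 linear0.
  apply/matrixP => i j; rewrite [RHS]mxE -bform_delta.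
  have := psd_cauchy_schwarz (delta_mx j 0) (delta_mx i 0) pS.
  rewrite !qform_delta; have := S0 j; have := S0 i; rewrite /= => /eqP -> _.
  rewrite mulr0 => h; apply/eqP; rewrite -sqrf_eq0 eq_le h /=.
  exact: sqr_ge0.
have Sii : 0 < S i i by rewrite lt0r Si psd_diag_ge0.
have sS := proj1 pS.
pose w := S *m (delta_mx i 0 : 'cV_n).
have wE (u : 'cV[R]_n) :
    (u^T *m w) 0 0 = ((delta_mx i 0 : 'cV_n)^T *m S *m u) 0 0.
  by rewrite mulmxA; exact: qform_row.
pose S' := S - (S i i)^-1 *: (w *m w^T).
have pS' : psd S'.
  split; first by apply/symmB/symmZ/symm_rank1.
  move=> u; rewrite qformB qformZ qform_rank1 wE subr_ge0 ler_pdivrMl //.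
  by have := psd_cauchy_schwarz u (delta_mx i 0) pS; rewrite qform_delta mulrC.
have -> : S = S' + (S i i)^-1 *: (w *m w^T) by rewrite subrK.
rewrite trdotDr trdotZr trdot_rank1 addr_ge0 //; last first.
  by rewrite mulr_ge0 ?invr_ge0 ?(ltW Sii) //; apply: (proj2 pZ).
apply: IH => //; apply: leq_trans leS; apply/proper_card/properP; split.
  apply/fintype.subsetP => j; rewrite !inE; apply: contra => /eqP Sj.
  rewrite -qform_delta qformB qformZ qform_rank1 qform_delta Sj.
  rewrite wE bform_delta.
  have := psd_cauchy_schwarz (delta_mx j 0) (delta_mx i 0) pS.
  rewrite bform_delta !qform_delta Sj mul0r => h.
  have -> : S i j = 0.
    by apply/eqP; rewrite -sqrf_eq0 eq_le h /= sqr_ge0.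
  by rewrite expr0n /= mulr0 subr0.
exists i; rewrite ?inE // negbK; apply/eqP.
rewrite -qform_delta qformB qformZ qform_rank1 wE bform_delta qform_delta.
by field.
Qed.

(** By Cauchy-Schwarz [v v^T <= (v^T Y v) Y^-1] in the semidefinite order; pairing both sides with
    [C] gives the bound. It provides an explicit [t] with [C <= t Y]. *)
Lemma psd_le_trace (R : realType) (n : nat) (C Y : 'M[R]_n) v :
  psd C -> posdef Y -> qform C v <= trdot (invmx Y) C * qform Y v.
Proof.
move=> pC pY; have [->|v0] := eqVneq v 0; first by rewrite !qform0 mulr0.
have q0 := posdef_gt0 pY v0.
rewrite -ler_pdivrMr // -subr_ge0.
have -> : qform C v / qform Y v = trdot ((qform Y v)^-1 *: (v *m v^T)) C.
  by rewrite trdotZl trdotC trdot_rank1 mulrC.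
rewrite -trdotBl; apply: trdot_psd_ge0 => //; split.
  by apply: symmB; [apply/symm_inv; case: pY | apply/symmZ/symm_rank1].
move=> u; rewrite qformB qformZ qform_rank1 subr_ge0 ler_pdivrMl // mulrC.
exact: posdef_cauchy_schwarz.
Qed.

(** Cauchy-Schwarz against each basis vector, summed. It replaces a lower bound on the smallest
    eigenvalue of [X]. *)
Lemma posdef_norm_le (R : realType) (n : nat) (X : 'M[R]_n) u :
  posdef X -> qform 1%:M u <= \tr (invmx X) * qform X u.
Proof.
move=> pX; rewrite qform1 /mxtrace mulr_suml; apply: ler_sum => i _.
by rewrite -qform_delta -delta_coord; apply: posdef_cauchy_schwarz.
Qed.

Lemma qform_bound (R : realType) (n : nat) (B : 'M[R]_n) (e : R) u :
  (forall i j, `|B i j| <= e) -> `|qform B u| <= e * n%:R * qform 1%:M u.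
Proof.
move=> Be; rewrite qform1 /qform mxE.
have -> : \sum_j (u^T *m B) 0 j * u j 0 = \sum_j \sum_i u i 0 * B i j * u j 0.
  apply: eq_bigr => j _; rewrite mxE mulr_suml; apply: eq_bigr => i _.
  by rewrite mxE.
apply: le_trans (ler_norm_sum _ _ _) _.
have -> : e * n%:R * (\sum_i u i 0 ^+ 2) =
    \sum_(j < n) \sum_(i < n) e * ((u i 0 ^+ 2 + u j 0 ^+ 2) / 2).
  transitivity (\sum_(j < n) (e / 2 * (\sum_(i < n) u i 0 ^+ 2)
      + n%:R * (e / 2) * u j 0 ^+ 2)).
    by rewrite big_split /= sumr_const card_ord -mulr_natl -mulr_sumr; field.
  apply: eq_bigr => j _.
  transitivity (\sum_(i < n) (e / 2 * u i 0 ^+ 2 + e / 2 * u j 0 ^+ 2)).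
    by rewrite big_split /= sumr_const card_ord -mulr_sumr; field.
  by apply: eq_bigr => i _; field.
apply: ler_sum => j _; apply: le_trans (ler_norm_sum _ _ _) _.
apply: ler_sum => i _; rewrite !normrM.
have h : `|u i 0| * `|u j 0| <= (u i 0 ^+ 2 + u j 0 ^+ 2) / 2.
  rewrite -(real_normK (num_real (u i 0))) -(real_normK (num_real (u j 0))).
  by have := sqr_ge0 (`|u i 0| - `|u j 0|); lra.
rewrite mulrAC mulrC; apply: ler_pM => //.
Qed.

Lemma posdef_open (R : realType) (n : nat) (X : 'M[R]_n) :
  posdef X -> exists2 e : R, 0 < e &
    forall B, symm B -> (forall i j, `|B i j| <= e) -> posdef (X + B).
Proof.
move=> pX; set c := \tr (invmx X).
have c0 : 0 <= c.
  by apply: sumr_ge0 => i _; apply: psd_diag_ge0; apply/posdef_psd/posdef_inv.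
have d0 : 0 < n%:R * c + 1 by rewrite ltr_wpDl // mulr_ge0.
(* A perturbation of this size changes the form by at most the fraction [n c / (n c + 1)] of
   [qform X u]; the [+ 1] makes this fraction less than 1. *)
exists (n%:R * c + 1)^-1; first by rewrite invr_gt0.
move=> B sB Be; split; first by apply: symmD => //; case: pX.
move=> u u0; rewrite -/(qform _ u) qformD.
have := qform_bound u Be; rewrite ler_norml => /andP[h _].
rewrite -(opprK (qform B u)) subr_gt0.
apply: le_lt_trans (_ : _ <= (n%:R * c) / (n%:R * c + 1) * qform X u) _.
  rewrite lerNl; apply: le_trans h; rewrite lerN2.
  have := ler_wpM2l (ltW (divr_gt0 ltr01 d0))
    (ler_wpM2l (ler0n R n) (posdef_norm_le u pX)).
  by congr (_ <= _); rewrite -?/c; field; rewrite gt_eqF.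
rewrite gtr_pMl; last exact: posdef_gt0.
by rewrite ltr_pdivrMr // mul1r ltrDl.
Qed.

Lemma posdef_line (R : realType) (n : nat) (X A : 'M[R]_n) :
  posdef X -> symm A -> exists2 e : R, 0 < e &
    forall t, `|t| <= e -> posdef (X + t *: A).
Proof.
move=> pX sA; have [e e0 h] := posdef_open pX.
have N0 : 0 < 1 + \sum_i \sum_j `|A i j|.
  by rewrite ltr_pwDl // !sumr_ge0 // => i _; rewrite sumr_ge0.
exists (e / (1 + \sum_i \sum_j `|A i j|)); first by rewrite divr_gt0.
move=> t te; apply: h => [|i j]; first exact: symmZ.
rewrite mxE normrM; apply: le_trans (ler_wpM2r _ te) _ => //.
rewrite mulrAC ler_pdivrMr // ler_pM2l //.
rewrite (bigD1 i) //= (bigD1 j) //=.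
have : 0 <= \sum_(j0 < n | j0 != j) `|A i j0| by rewrite sumr_ge0.
have : 0 <= \sum_(i0 < n | i0 != i) \sum_j0 `|A i0 j0|.
  by rewrite sumr_ge0 // => k _; rewrite sumr_ge0.
lra.
Qed.

(** * Linear automorphisms of the cone *)

Lemma psd_limit (R : realType) (n : nat) (Y P : 'M[R]_n) :
  symm Y -> (forall e, 0 < e -> posdef (Y + e *: P)) -> psd Y.
Proof.
move=> sY h; split=> // u; have [->|u0] := eqVneq u 0; first by rewrite qform0.
apply/ler_addgt0Pr => e e0.
have d0 : 0 < `|qform P u| + 1 by rewrite ltr_wpDl.
have := posdef_gt0 (h _ (divr_gt0 e0 d0)) u0; rewrite qformD qformZ => /ltW.
move=> /le_trans; apply; rewrite lerD2l mulrAC ler_pdivrMr // ler_pM2l //.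
by apply: le_trans (ler_norm _) _; rewrite lerDl.
Qed.

Lemma psd_perturb (R : realType) (n : nat) (Y P : 'M[R]_n) e :
  psd Y -> posdef P -> 0 < e -> posdef (Y + e *: P).
Proof. by move=> pY pP e0; rewrite addrC; apply/posdefD/pY/posdefZ. Qed.

Lemma psd_anti (R : realType) (n : nat) (A B : 'M[R]_n) :
  psd (A - B) -> psd (B - A) -> A = B.
Proof.
move=> [s1 p1] [s2 p2]; apply/eqP; rewrite -subr_eq0; apply/eqP.
apply: qform_eq0 => // u; apply/eqP; rewrite eq_le p1 andbT.
by have := p2 u; rewrite !qformB; lra.
Qed.

(** All conditions concern symmetric arguments only, since [hessian] is a [get] whose value
    elsewhere is not controlled. *)
Record cone_aut (R : realType) (n : nat) (q : 'M[R]_n -> 'M[R]_n) : Prop := {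
  cone_aut_symm : forall A, symm A -> symm (q A);
  cone_aut_linear : forall a A B, symm A -> symm B ->
    q (a *: A + B) = a *: q A + q B;
  cone_aut_adj : forall A B, symm A -> symm B ->
    trdot (q A) B = trdot A (q B);
  cone_aut_surj : forall B, symm B -> exists2 A, symm A & q A = B;
  cone_aut_pos : forall X, symm X -> posdef (q X) <-> posdef X }.

Lemma cone_autD (R : realType) (n : nat) (q : 'M[R]_n -> 'M[R]_n) A B :
  cone_aut q -> symm A -> symm B -> q (A + B) = q A + q B.
Proof.
by move=> cq sA sB; rewrite -[A]scale1r (cone_aut_linear cq) // !scale1r.
Qed.

Lemma cone_aut0 (R : realType) (n : nat) (q : 'M[R]_n -> 'M[R]_n) :
  cone_aut q -> q 0 = 0.
Proof.
move=> cq; have := cone_autD cq (symm0 R n) (symm0 R n).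
by rewrite addr0 => /eqP; rewrite -subr_eq subrr eq_sym => /eqP.
Qed.

Lemma cone_autZ (R : realType) (n : nat) (q : 'M[R]_n -> 'M[R]_n) a A :
  cone_aut q -> symm A -> q (a *: A) = a *: q A.
Proof.
move=> cq sA; rewrite -[a *: A]addr0 (cone_aut_linear cq) //; last exact: symm0.
by rewrite (cone_aut0 cq) addr0.
Qed.

Lemma cone_autB (R : realType) (n : nat) (q : 'M[R]_n -> 'M[R]_n) A B :
  cone_aut q -> symm A -> symm B -> q (A - B) = q A - q B.
Proof.
move=> cq sA sB; rewrite -scaleN1r (cone_autD cq) ?(cone_autZ _ cq) //.
  by rewrite scaleN1r.
exact: symmZ.
Qed.

(** A self-adjoint surjection has trivial kernel. *)
Lemma cone_aut_inj (R : realType) (n : nat) (q : 'M[R]_n -> 'M[R]_n) A B :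
  cone_aut q -> symm A -> symm B -> q A = q B -> A = B.
Proof.
move=> cq sA sB e; apply: trdot_inj => // C sC.
have [D sD <-] := cone_aut_surj cq sC.
by rewrite -!(cone_aut_adj cq) // e.
Qed.

(** The closed cone is reached as a limit, along the direction [1] on the side of [X] and along
    [q 1] on the side of [q X]. *)
Lemma cone_aut_psd (R : realType) (n : nat) (q : 'M[R]_n -> 'M[R]_n) X :
  cone_aut q -> symm X -> psd (q X) <-> psd X.
Proof.
move=> cq sX; have s1 := symm1 R n.
have p1 : posdef (q 1%:M) by apply/(cone_aut_pos cq) => //; exact: posdef1.
have qE e : q (X + e *: 1%:M) = q X + e *: q 1%:M.
  by rewrite (cone_autD cq) ?(cone_autZ _ cq) //; exact: symmZ.
split=> pX.
  apply: (psd_limit (P := 1%:M)) => // e e0.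
  apply/(cone_aut_pos cq); first by apply/symmD/symmZ.
  by rewrite qE; apply: psd_perturb.
apply: (psd_limit (P := q 1%:M)) => [|e e0]; first exact: (cone_aut_symm cq).
rewrite -qE; apply/(cone_aut_pos cq); first by apply/symmD/symmZ.
by apply: psd_perturb => //; exact: posdef1.
Qed.

Lemma cone_aut_inv (R : realType) (n : nat) (q : 'M[R]_n -> 'M[R]_n) :
  cone_aut q -> exists q', [/\ cone_aut q',
    forall A, symm A -> q' (q A) = A & forall A, symm A -> q (q' A) = A].
Proof.
move=> cq.
have /choice[q' q'P] : forall B, exists A, symm B -> symm A /\ q A = B.
  move=> B; case: (pselect (symm B)) => [sB|nB]; last by exists 0.
  by have [A sA qA] := cone_aut_surj cq sB; exists A.
have q's A : symm A -> symm (q' A) by move=> /q'P[].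
have qq' A : symm A -> q (q' A) = A by move=> /q'P[].
have q'q A : symm A -> q' (q A) = A.
  move=> sA; have sqA := cone_aut_symm cq sA.
  by apply: (cone_aut_inj cq) => //; [exact: q's | exact: qq'].
exists q'; split=> //; split=> //.
- move=> a A B sA sB; apply: (cone_aut_inj cq).
  + by apply/q's/symmD => //; exact: symmZ.
  + by apply: symmD; [apply/symmZ/q's | exact: q's].
  + rewrite qq'; last by apply: symmD => //; exact: symmZ.
    by rewrite (cone_aut_linear cq) ?qq' //; exact: q's.
- move=> A B sA sB.
  by rewrite -{1}(qq' B) // -(cone_aut_adj cq) ?qq' //; exact: q's.
- by move=> B sB; exists (q B); [exact: (cone_aut_symm cq) | exact: q'q].
- by move=> X sX; rewrite -{2}(qq' X) //; split=> /(cone_aut_pos cq);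
    apply; exact: q's.
Qed.

(** Put [s = <(q X)^-1, q (u u^T)>], which is the form of [q ((q X)^-1)] at [u]. By [psd_le_trace],
    [q (u u^T) <= s (q X)]; pulling this back through [q] gives [u u^T <= s X], and testing at
    [X^-1 u] gives [u^T X^-1 u <= s]. *)
Lemma cone_aut_inv_ge (R : realType) (n : nat) (q : 'M[R]_n -> 'M[R]_n) X :
  cone_aut q -> posdef X -> psd (q (invmx (q X)) - invmx X).
Proof.
move=> cq pX; have sX := proj1 pX; have sq := cone_aut_symm cq.
have pqX : posdef (q X) by apply/(cone_aut_pos cq).
have sI := symm_inv (proj1 pqX).
split; first by apply/symmB/symm_inv => //; exact: sq.
move=> u.
rewrite qformB subr_ge0 -(trdot_rank1 (q _)) (cone_aut_adj cq) //; last first.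
  exact: symm_rank1.
set C := q (u *m u^T); set s := trdot _ _.
have pC : psd C.
  by apply/(cone_aut_psd cq); [exact: symm_rank1 | exact: psd_rank1].
have [->|u0] := eqVneq u 0.
  rewrite qform0; apply: trdot_psd_ge0 => //; exact/posdef_psd/posdef_inv.
have a0 : 0 < qform (invmx X) u by apply: posdef_gt0 => //; exact: posdef_inv.
have : psd (s *: X - u *m u^T).
  have sZ := symmZ s sX; have su := symm_rank1 u.
  apply/(cone_aut_psd cq); first exact: symmB.
  rewrite (cone_autB cq) // (cone_autZ _ cq) //; split.
    by apply/symmB/sq => //; apply/symmZ/sq.
  by move=> v; rewrite qformB qformZ subr_ge0; exact: psd_le_trace.
case=> _ /(_ (invmx X *m u)); rewrite qformB qformZ qform_rank1.
have -> : qform X (invmx X *m u) = qform (invmx X) u.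
  rewrite /qform trmx_mul (symm_tr (symm_inv sX)) -!mulmxA (mulmxA X).
  by rewrite mulmxV ?mul1mx //; exact: posdef_unit.
have -> : ((invmx X *m u)^T *m u) 0 0 = qform (invmx X) u.
  by rewrite /qform trmx_mul (symm_tr (symm_inv sX)).
by rewrite subr_ge0 expr2 ler_pM2r.
Qed.

(** One inequality is [cone_aut_inv_ge] for [q] at [X]; the other is the same lemma for the inverse
    of [q] at [q X], mapped forward by [q]. *)
Lemma cone_aut_invmx (R : realType) (n : nat) (q : 'M[R]_n -> 'M[R]_n) X :
  cone_aut q -> posdef X -> q (invmx (q X)) = invmx X.
Proof.
move=> cq pX; have [q' [cq' q'q qq']] := cone_aut_inv cq.
have sX := proj1 pX; have sq := cone_aut_symm cq.
have pqX : posdef (q X) by apply/(cone_aut_pos cq).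
have sI := symm_inv (proj1 pqX); have sJ := symm_inv sX.
apply: psd_anti; first exact: cone_aut_inv_ge.
have := cone_aut_inv_ge cq' pqX; rewrite q'q // => h.
rewrite -{1}(qq' (invmx X)) // -(cone_autB cq) //; last first.
  exact: (cone_aut_symm cq').
by apply/(cone_aut_psd cq) => //; case: h.
Qed.

(* Hua's identity [X - X Y X = (X^-1 + (Y^-1 - X)^-1)^-1] writes the quadratic *)
(* map [X |-> X Y X] with inverses, which [cone_aut_invmx] transports.         *)
Lemma hua (R : realType) (n : nat) (X Y : 'M[R]_n) :
  X \in unitmx -> Y \in unitmx -> invmx Y - X \in unitmx ->
  invmx (invmx X + invmx (invmx Y - X)) = X - X *m Y *m X.
Proof.
move=> uX uY; set M := invmx Y - X => uM.
have E : (invmx X + invmx M) *m (X - X *m Y *m X) = 1%:M.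
  rewrite mulmxDl.
  have -> : invmx M *m (X - X *m Y *m X) = Y *m X.
    have -> : X - X *m Y *m X = M *m (Y *m X).
      by rewrite /M mulmxBl !mulmxA mulVmx // mul1mx.
    by rewrite mulmxA mulVmx // mul1mx.
  by rewrite mulmxBr !mulmxA mulVmx // mul1mx subrK.
have [uS _] := mulmx1_unit E.
by rewrite -[LHS]mulmx1 -E mulmxA mulVmx // mul1mx.
Qed.

(** The last hypothesis makes the matrices inverted in Hua's identity positive definite. With
    [U = X^-1 + ((q V)^-1 - X)^-1], [cone_aut_invmx] says that [q (U^-1)] is the inverse of [q' U],
    and Hua's identity evaluates both sides. *)
Lemma cone_aut_quad_posdef (R : realType) (n : nat) (q : 'M[R]_n -> 'M[R]_n)
    X V :
  cone_aut q -> posdef X -> posdef V -> posdef (invmx (q V) - X) ->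
  q (X *m q V *m X) = q X *m V *m q X.
Proof.
move=> cq pX pV pM; have sX := proj1 pX; have sV := proj1 pV.
have sq := cone_aut_symm cq.
have [q' [cq' q'q qq']] := cone_aut_inv cq.
have pos Z : posdef Z -> posdef (q Z).
  by move=> pZ; apply/(cone_aut_pos cq) => //; case: pZ.
have pU : posdef (invmx X + invmx (invmx (q V) - X)).
  by apply: posdefD; [exact: posdef_inv | exact/posdef_psd/posdef_inv].
have q'inv Z : posdef Z -> q' (invmx Z) = invmx (q Z).
  move=> pZ; rewrite -(cone_aut_invmx cq pZ) q'q //.
  by apply/symm_inv/sq; case: pZ.
have e1 := hua (posdef_unit pX) (posdef_unit (pos _ pV)) (posdef_unit pM).
set U := invmx X + _ in pU e1.
have pU' : posdef (q' U) by apply/(cone_aut_pos cq'); case: pU.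
have := cone_aut_invmx cq pU'; rewrite qq'; last by case: pU.
rewrite e1 /U (cone_autD cq') ?q'inv //; last first.
- by apply/symm_inv; case: pM.
- exact: symm_inv.
have -> : q (invmx (q V) - X) = invmx V - q X.
  rewrite (cone_autB cq) ?(cone_aut_invmx cq) //.
  by apply/symm_inv/sq.
have pM' : posdef (invmx V - q X).
  rewrite -(cone_aut_invmx cq pV) -(cone_autB cq) //; first exact: pos.
  exact/symm_inv/sq.
rewrite (hua (posdef_unit (pos _ pX)) (posdef_unit pV) (posdef_unit pM')).
rewrite (cone_autB cq) //; last exact/symm_conj/sq.
by move=> /addrI /oppr_inj.
Qed.

Lemma cone_aut_quad (R : realType) (n : nat) (q : 'M[R]_n -> 'M[R]_n) X V :
  cone_aut q -> posdef X -> symm V ->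
  q (X *m q V *m X) = q X *m V *m q X.
Proof.
move=> cq pX sV; have sX := proj1 pX; have sq := cone_aut_symm cq.
(* Both sides are homogeneous in [W], so [W] may be shrunk until [(q (e W))^-1] exceeds [X]. *)
have quadpos W : posdef W -> q (X *m q W *m X) = q X *m W *m q X.
  move=> pW; have sW := proj1 pW.
  have pqW : posdef (q W) by apply/(cone_aut_pos cq).
  have [e e0 he] := posdef_line (posdef_inv pqW) (symmZ (-1) sX).
  have eW : posdef (e *: W) by exact: posdefZ.
  have : q (X *m q (e *: W) *m X) = q X *m (e *: W) *m q X.
    apply: cone_aut_quad_posdef => //.
    rewrite (cone_autZ _ cq) // invmxZ; last first.
      by apply/posdef_unit/posdefZ.
    have -> : e^-1 *: invmx (q W) - X = e^-1 *: (invmx (q W) + e *: (-1 *: X)).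
      by rewrite scalerDr !scalerA mulVf ?gt_eqF // mul1r scaleN1r.
    by apply: posdefZ; [rewrite invr_gt0 | apply: he; rewrite gtr0_norm].
  rewrite (cone_autZ _ cq) // -!scalemxAr -!scalemxAl.
  rewrite (cone_autZ _ cq); last first.
    exact/symm_conj/sq.
  by move/scalerI; apply; rewrite gt_eqF.
(* A symmetric [V] is a multiple of the difference of the positive definite matrices [1 + e V] and
   [1], and both sides are linear in [V]. *)
have [e e0 he] := posdef_line (posdef1 R n) sV.
have p1 := posdef1 R n; have s1 := symm1 R n.
have := quadpos _ (he e _); rewrite gtr0_norm // => /(_ (lexx _)).
have sZ := symmZ e sV.
rewrite (cone_autD cq) // (cone_autZ _ cq) // !(mulmxDl, mulmxDr).
rewrite -!scalemxAr -!scalemxAl.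
rewrite (cone_autD cq) ?(cone_autZ _ cq) ?(quadpos 1%:M) //.
- by move=> /addrI /scalerI; apply; rewrite gt_eqF.
- exact/symm_conj/sq.
- exact/symm_conj/sq.
- exact/symmZ/symm_conj/sq.
Qed.

(** * Directional derivatives on the cone *)

Local Open Scope classical_set_scope.

Lemma is_derive_cvgP (R : realType) (V : normedModType R) (f : V -> R)
    (x v : V) (d : R) :
  is_derive x v f d <->
  h^-1 * (f (x + h *: v) - f x) @[h --> 0^'] --> d.
Proof.
have E : (fun h : R => h^-1 *: ((f \o shift x) (h *: v) - f x)) =
    (fun h : R => h^-1 * (f (x + h *: v) - f x)).
  by apply/funext => h /=; rewrite [x + _]addrC.
split=> [[df <-]|fd].
  by rewrite -E; exact: df.
split; first by apply/cvg_ex; exists d; rewrite E.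
by rewrite /derive E; apply/cvg_lim.
Qed.

Lemma is_derive_affine (R : realType) (V : normedModType R) (f : V -> R)
    (x v : V) (t d : R) :
  is_derive (x + t *: v) v f d ->
  is_derive t 1 (fun s : R => f (x + s *: v)) d.
Proof.
move=> /is_derive_cvgP h; apply/is_derive_cvgP.
suff -> : (fun h0 : R => h0^-1 * (f (x + (t + h0 *: 1) *: v) - f (x + t *: v)))
  = (fun h0 => h0^-1 * (f (x + t *: v + h0 *: v) - f (x + t *: v))) by [].
by apply/funext => s; rewrite [s *: 1]mulr1 scalerDl addrA.
Qed.

Lemma is_derive_translate (R : realType) (V : normedModType R) (f : V -> R)
    (x v z : V) (d : R) :
  is_derive (x + z) v f d -> is_derive x v (fun y => f (y + z)) d.
Proof.
move=> /is_derive_cvgP h; apply/is_derive_cvgP.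
suff -> : (fun h0 : R => h0^-1 * (f (x + h0 *: v + z) - f (x + z)))
  = (fun h0 => h0^-1 * (f (x + z + h0 *: v) - f (x + z))) by [].
by apply/funext => s; rewrite addrAC.
Qed.

Lemma mvt_line (R : realType) (V : normedModType R) (f : V -> R)
    (x v : V) (h : R) :
  (forall s : R, `|s| <= `|h| -> derivable f (x + s *: v) v) ->
  exists2 s : R, `|s| <= `|h| & f (x + h *: v) - f x = h * 'D_v f (x + s *: v).
Proof.
move=> df.
have dg (s : R) : `|s| <= `|h| ->
    is_derive s 1 (fun s : R => f (x + s *: v)) ('D_v f (x + s *: v)).
  by move=> sh; apply/is_derive_affine/derivableP/df.
have [h0|h0] := leP 0 h.
  have sub s : s \in `[0, h]%R -> `|s| <= `|h|.
    by rewrite in_itv /= => /andP[s0 sh]; rewrite !ger0_norm.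
  have [||c /sub ch E] := MVT_segment (f := fun s : R => f (x + s *: v))
      (df := fun s => 'D_v f (x + s *: v)) h0.
  - by move=> s /subset_itv_oo_cc /sub; exact: dg.
  - by apply: derivable_within_continuous => s /sub /dg [].
  exists c => //; move: E; rewrite scale0r addr0 => ->.
  by rewrite subr0 mulrC.
have sub s : s \in `[h, 0]%R -> `|s| <= `|h|.
  rewrite in_itv /= => /andP[s0 sh]; rewrite ler0_norm // ltr0_norm //.
  by rewrite lerN2.
have [||c /sub ch E] := MVT_segment (f := fun s : R => f (x + s *: v))
    (df := fun s => 'D_v f (x + s *: v)) (ltW h0).
- by move=> s /subset_itv_oo_cc /sub; exact: dg.
- by apply: derivable_within_continuous => s /sub /dg [].
exists c => //; move: E; rewrite scale0r addr0 sub0r => /eqP.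
by rewrite mulrN -eqr_oppLR opprB mulrC => /eqP.
Qed.

(** Small symmetric displacements stay in the cone, so an identity valid only there may still be
    differentiated. *)
Lemma is_derive_posdef (R : realType) (n : nat) (f g : 'M[R]_n -> R)
    (X A : 'M[R]_n) (d : R) :
  posdef X -> symm A -> (forall Y, posdef Y -> f Y = g Y) ->
  is_derive X A f d -> is_derive X A g d.
Proof.
move=> pX sA fg /is_derive_cvgP h; apply/is_derive_cvgP.
have [e e0 he] := posdef_line pX sA.
apply: cvg_trans h; apply: near_eq_cvg; near=> t.
rewrite !fg //; apply: he; near: t; exact: dnbhs0_le.
Unshelve. all: by end_near. Qed.

Lemma derive_posdef (R : realType) (n : nat) (f g : 'M[R]_n -> R)
    (X A : 'M[R]_n) :
  posdef X -> symm A -> (forall Y, posdef Y -> f Y = g Y) ->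
  derivable f X A -> 'D_A f X = 'D_A g X.
Proof.
move=> pX sA fg /derivableP df.
by have [_ ->] := is_derive_posdef pX sA fg df.
Qed.

Lemma posdef_plane (R : realType) (n : nat) (X A B : 'M[R]_n) :
  posdef X -> symm A -> symm B -> exists2 d : R, 0 < d &
    forall s t : R, `|s| <= d -> `|t| <= d -> posdef (X + s *: A + t *: B).
Proof.
move=> pX sA sB; have [a a0 ha] := posdef_line pX sA.
have [b b0 hb] := posdef_line pX sB.
exists (Num.min (a / 2) (b / 2)) => [|s t].
  by rewrite lt_min !divr_gt0.
rewrite !le_min => /andP[sa _] /andP[_ tb].
(* The point is the midpoint of [X + 2 s A] and [X + 2 t B], so one-dimensional openness
   suffices. *)
have -> : X + s *: A + t *: B =
    2^-1 *: (X + (2 * s) *: A) + 2^-1 *: (X + (2 * t) *: B).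
  rewrite !scalerDr !scalerA !mulKf // addrACA -scalerDl.
  have -> : 2^-1 + 2^-1 = 1 :> R by field.
  by rewrite scale1r addrA.
apply: posdefD.
  by apply: posdefZ => //; apply: ha; rewrite normrM ger0_norm; lra.
apply/posdef_psd; apply: posdefZ => //; apply: hb.
by rewrite normrM ger0_norm; lra.
Qed.

Lemma within_posdef_near (R : realType) (n : nat) (g : 'M[R]_n -> R)
    (X A B : 'M[R]_n) (e : R) :
  posdef X -> symm A -> symm B -> {within @posdef R n, continuous g} -> 0 < e ->
  exists2 d : R, 0 < d & forall s t : R, `|s| <= d -> `|t| <= d ->
    posdef (X + s *: A + t *: B) /\ `|g X - g (X + s *: A + t *: B)| < e.
Proof.
move=> pX sA sB /subspace_continuousP /(_ X pX) /cvgrPdist_lt gX e0.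
have [a a0 ha] := posdef_plane pX sA sB.
have /nbhs_normP[b /= b0 hb] := gX _ e0.
have N0 : 0 < `|A| + `|B| + 1 by rewrite ltr_wpDl // addr_ge0.
exists (Num.min a (b / 3 / (`|A| + `|B| + 1))) => [|s t].
  by rewrite lt_min a0 !divr_gt0.
rewrite !le_min => /andP[sa sb] /andP[ta tb]; split; first exact: ha.
apply: hb; last exact: ha.
rewrite /= -addrA opprD addrA subrr sub0r normrN.
apply: le_lt_trans (ler_normD _ _) _; rewrite !normrZ.
move: sb tb; rewrite !ler_pdivlMr // => sb tb.
have : `|s| * `|A| <= `|s| * (`|A| + `|B| + 1).
  by rewrite ler_wpM2l // -addrA lerDl addr_ge0.
have : `|t| * `|B| <= `|t| * (`|A| + `|B| + 1).
  by rewrite ler_wpM2l // addrAC addrC lerDl addr_ge0.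
rewrite /=; lra.
Qed.

(** * Functions of class C^k on the cone: linearity in the direction and symmetry of second
    derivatives *)

Lemma class_C_continuous (R : realType) (n k : nat) (f : 'M[R]_n -> R) :
  class_C k f -> {within @posdef R n, continuous f}.
Proof. by case: k => [|k] []. Qed.

Lemma class_CW (R : realType) (n k : nat) (f : 'M[R]_n -> R) :
  class_C k.+1 f -> class_C k f.
Proof.
elim: k f => [|k IH] f [cf df]; first by split.
by split=> // A sA; have [d1 d2] := df A sA; split=> //; exact: IH.
Qed.

Lemma class_C_derivable (R : realType) (n k : nat) (f : 'M[R]_n -> R) X A :
  class_C k.+1 f -> posdef X -> symm A -> derivable f X A.
Proof. by move=> [_ df] pX sA; have [d1 _] := df A sA; exact: d1. Qed.

Lemma class_C_derive (R : realType) (n k : nat) (f : 'M[R]_n -> R) A :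
  class_C k.+1 f -> symm A -> class_C k ('D_A f).
Proof. by move=> [_ df] sA; have [] := df A sA. Qed.

(** [class_C] speaks of directional derivatives only, so linearity in the direction must be earned:
    the displacement is split into a leg along [A] and a leg along [B], with the mean value theorem
    on each leg and continuity of the derivatives. *)
Lemma is_derive_linear_direction (R : realType) (n : nat) (f : 'M[R]_n -> R)
    (X A B : 'M[R]_n) (a b : R) :
  class_C 1 f -> posdef X -> symm A -> symm B ->
  is_derive X (a *: A + b *: B) f (a * 'D_A f X + b * 'D_B f X).
Proof.
move=> cf pX sA sB; apply/is_derive_cvgP/cvgrPdist_lt => e e0.
have N0 : 0 < `|a| + `|b| + 1 by rewrite ltr_wpDl // addr_ge0.
have e1 : 0 < e / (`|a| + `|b| + 1) by rewrite divr_gt0.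
have [d1 d10 h1] := within_posdef_near pX sA sB
  (class_C_continuous (class_C_derive cf sA)) e1.
have [d2 d20 h2] := within_posdef_near pX sA sB
  (class_C_continuous (class_C_derive cf sB)) e1.
have d30 : 0 < Num.min d1 d2 / (`|a| + `|b| + 1).
  by rewrite divr_gt0 // lt_min d10.
near=> h.
have h0 : h != 0 by near: h; exact: nbhs_dnbhs_neq.
have : `|h| <= Num.min d1 d2 / (`|a| + `|b| + 1).
  by near: h; exact: dnbhs0_le.
rewrite ler_pdivlMr // le_min => /andP[hd1 hd2].
have bnd (c s d : R) : `|h| * (`|a| + `|b| + 1) <= d ->
    `|c| <= `|a| + `|b| + 1 -> `|s| <= `|h * c| -> `|s| <= d.
  move=> hd ca sc; apply: le_trans sc (le_trans _ hd).
  by rewrite normrM ler_wpM2l.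
have aN : `|a| <= `|a| + `|b| + 1 by rewrite -addrA lerDl addr_ge0.
have bN : `|b| <= `|a| + `|b| + 1 by rewrite addrAC addrC lerDl addr_ge0.
have [s sh Es] : exists2 s : R, `|s| <= `|h * a| &
    f (X + (h * a) *: A) - f X = h * a * 'D_A f (X + s *: A).
  apply: mvt_line => s sh; apply: (class_C_derivable cf) => //.
  have [|+ _] := h1 s 0 (bnd _ _ _ hd1 aN sh); first by rewrite normr0 ltW.
  by rewrite scale0r addr0.
have haA : `|h * a| <= d2 by apply: bnd hd2 aN (lexx _).
have [t th Et] : exists2 t : R, `|t| <= `|h * b| &
    f (X + (h * a) *: A + (h * b) *: B) - f (X + (h * a) *: A) =
      h * b * 'D_B f (X + (h * a) *: A + t *: B).
  apply: mvt_line => t th; apply: (class_C_derivable cf) => //.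
  by have [] := h2 (h * a) t haA (bnd _ _ _ hd2 bN th).
have [|_ ] := h1 s 0 (bnd _ _ _ hd1 aN sh); first by rewrite normr0 ltW.
rewrite scale0r addr0; move: Es; set p := 'D_A f (X + s *: A) => Es np.
have [_] := h2 (h * a) t haA (bnd _ _ _ hd2 bN th).
move: Et; set q := 'D_B f (X + _ + _) => Et nq.
have -> : f (X + h *: (a *: A + b *: B)) - f X = h * (a * p + b * q).
  rewrite scalerDr !scalerA addrA -(subrK (f (X + (h * a) *: A)) (f (_ + _))).
  by rewrite Et -addrA Es; ring.
rewrite mulKf //.
have -> : a * 'D_A f X + b * 'D_B f X - (a * p + b * q) =
  a * ('D_A f X - p) + b * ('D_B f X - q) by ring.
apply: le_lt_trans (ler_normD _ _) _; rewrite !normrM.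
have lea : `|a| * `|'D_A f X - p| <= `|a| * (e / (`|a| + `|b| + 1)).
  by rewrite ler_wpM2l // ltW.
have leb : `|b| * `|'D_B f X - q| <= `|b| * (e / (`|a| + `|b| + 1)).
  by rewrite ler_wpM2l // ltW.
apply: le_lt_trans (lerD lea leb) _.
rewrite -mulrDl mulrCA gtr_pMr // ltr_pdivrMr // mul1r ltrDl.
by [].
Unshelve. all: by end_near. Qed.

Lemma derive_linear_direction (R : realType) (n : nat) (f : 'M[R]_n -> R)
    (X A B : 'M[R]_n) (a b : R) :
  class_C 1 f -> posdef X -> symm A -> symm B ->
  'D_(a *: A + b *: B) f X = a * 'D_A f X + b * 'D_B f X.
Proof.
move=> cf pX sA sB.
by have [_ ->] := is_derive_linear_direction a b cf pX sA sB.
Qed.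

(** Two mean value steps: along [A] for the increment of [f] by [h B], then along [B] for the
    derivative of [f] in direction [A]. *)
Lemma class_C_second_difference (R : realType) (n : nat) (f : 'M[R]_n -> R)
    (X A B : 'M[R]_n) (h : R) :
  class_C 2 f -> symm A -> symm B ->
  (forall s t : R, `|s| <= `|h| -> `|t| <= `|h| ->
    posdef (X + s *: A + t *: B)) ->
  exists s t : R, [/\ `|s| <= `|h|, `|t| <= `|h| &
    f (X + h *: A + h *: B) - f (X + h *: A) - f (X + h *: B) + f X =
    h * (h * 'D_B ('D_A f) (X + s *: A + t *: B))].
Proof.
move=> cf sA sB pos.
have pos0 s : `|s| <= `|h| -> posdef (X + s *: A).
  by move=> sh; have := pos s 0 sh; rewrite normr0 scale0r addr0; apply.
have dF s : `|s| <= `|h| -> is_derive (X + s *: A) A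
    (fun Y => f (Y + h *: B) - f Y)
    ('D_A f (X + s *: A + h *: B) - 'D_A f (X + s *: A)).
  move=> sh; apply: is_deriveB.
    apply/is_derive_translate/derivableP/(class_C_derivable cf) => //.
    exact: pos.
  by apply/derivableP/(class_C_derivable cf) => //; exact: pos0.
have [|s sh Es] := mvt_line (f := fun Y => f (Y + h *: B) - f Y)
    (x := X) (v := A) (h := h).
  by move=> s sh; have [] := dF s sh.
have [|t th Et] := mvt_line (f := 'D_A f) (x := X + s *: A) (v := B) (h := h).
  move=> t th; apply: (class_C_derivable (class_C_derive cf sA)) => //.
  exact: pos.
exists s, t; split=> //; have [_ Ed] := dF s sh.
by rewrite -Et -Ed -Es; ring.
Qed.

(** The second difference is symmetric in [A] and [B], so the two mixed derivatives agree at points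
    arbitrarily close to [X]. *)
Lemma class_C_schwarz (R : realType) (n : nat) (f : 'M[R]_n -> R)
    (X A B : 'M[R]_n) :
  class_C 2 f -> posdef X -> symm A -> symm B ->
  'D_A ('D_B f) X = 'D_B ('D_A f) X.
Proof.
move=> cf pX sA sB; apply/eqP; rewrite -subr_eq0 -normr_le0.
apply/ler_addgt0Pr => e e0; rewrite add0r.
have e20 : 0 < e / 2 by rewrite divr_gt0.
have [d1 d10 h1] := within_posdef_near pX sA sB
  (class_C_continuous (class_C_derive (class_C_derive cf sA) sB)) e20.
have [d2 d20 h2] := within_posdef_near pX sB sA
  (class_C_continuous (class_C_derive (class_C_derive cf sB) sA)) e20.
pose h := Num.min d1 d2.
have h0 : 0 < h by rewrite lt_min d10.
have hE : `|h| = h by rewrite gtr0_norm.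
have hd1 : h <= d1 by rewrite ge_min lexx.
have hd2 : h <= d2 by rewrite ge_min lexx orbT.
have [|s [t [sh th E1]]] :=
    class_C_second_difference (h := h) (X := X) cf sA sB.
  move=> s t; rewrite hE => sh th.
  by have [] := h1 s t (le_trans sh hd1) (le_trans th hd1).
have [|s' [t' [sh' th' E2]]] :=
    class_C_second_difference (h := h) (X := X) cf sB sA.
  move=> s' t'; rewrite hE => sh' th'.
  by have [] := h2 s' t' (le_trans sh' hd2) (le_trans th' hd2).
rewrite hE in sh th sh' th'.
have [_] := h1 s t (le_trans sh hd1) (le_trans th hd1).
have [_] := h2 s' t' (le_trans sh' hd2) (le_trans th' hd2).
move: E1 E2; set p := 'D_B ('D_A f) (_ + _); set q := 'D_A ('D_B f) (_ + _).
clearbody p q; rewrite [X + h *: B + _]addrAC => E1 E2.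
have -> : q = p.
  have : h * (h * q) = h * (h * p) by rewrite -E1 -E2; ring.
  by move=> /(mulfI (lt0r_neq0 h0)) /(mulfI (lt0r_neq0 h0)).
move: ('D_B ('D_A f) X) ('D_A ('D_B f) X) => u v.
rewrite !ltr_norml ler_norml => /andP[? ?] /andP[? ?].
by apply/andP; split; lra.
Qed.

Lemma derive_scaled (R : realType) (n : nat) (f : 'M[R]_n -> R)
    (X A : 'M[R]_n) (t a b : R) :
  class_C 1 f -> 0 < t -> posdef X -> symm A ->
  (forall Y, posdef Y -> f (t *: Y) = a * f Y + b) ->
  'D_A f (t *: X) = t^-1 * (a * 'D_A f X).
Proof.
move=> cf t0 pX sA ft.
have ptX : posdef (t *: X) by exact: posdefZ.
have d1 : is_derive X A (fun Y => f (t *: Y)) (t * 'D_A f (t *: X)).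
  have := is_derive_linear_direction t 0 cf ptX sA sA.
  rewrite scale0r addr0 mul0r addr0 => /is_derive_cvgP h; apply/is_derive_cvgP.
  suff -> : (fun h => h^-1 * (f (t *: (X + h *: A)) - f (t *: X))) =
    (fun h => h^-1 * (f (t *: X + h *: (t *: A)) - f (t *: X))) by [].
  by apply/funext => k; rewrite scalerDr !scalerA [t * k]mulrC.
have d2 : is_derive X A (fun Y => a * f Y + b) (a * 'D_A f X).
  apply: is_derive_eq; first apply: is_deriveD.
    apply: is_deriveZ; apply: derivableP; exact: class_C_derivable cf _ _.
  by rewrite addr0.
have [_ E] := is_derive_posdef pX sA ft d1.
by case: d2 => _; rewrite E => <-; rewrite mulKf // gt_eqF.
Qed.

Lemma is_derive_radial (R : realType) (n : nat) (f : 'M[R]_n -> R)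
    (phi : R -> R) (X : 'M[R]_n) (d : R) :
  (forall t, 0 < t -> f (t *: X) = phi t) -> is_derive (1 : R) (1 : R) phi d ->
  is_derive X X f d.
Proof.
move=> fphi /is_derive_cvgP h; apply/is_derive_cvgP.
apply: cvg_trans h; apply: near_eq_cvg; near=> t.
have t1 : `|t| < 1 by near: t; exact: dnbhs0_lt.
have t0 : 0 < 1 + t by move: t1; rewrite ltr_norml => /andP[]; lra.
have E : X + t *: X = (1 + t) *: X by rewrite scalerDl scale1r.
by rewrite E (fphi _ t0) [t *: 1]mulr1 -(fphi 1) ?scale1r.
Unshelve. all: by end_near. Qed.

(** * The third derivative of the barrier *)

(** For [K = E_ij - E_ji], the [(i, i)] entry of [M K = K M^T] reads [- M i j = M i j], and the
    [(i, j)] entry reads [M i i = M j j]. *)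
Lemma mul_delta_eq_scalar (R : realType) (n : nat) (M : 'M[R]_n) :
  (forall i j, i != j ->
    M *m (delta_mx i j - delta_mx j i) =
    (delta_mx i j - delta_mx j i) *m M^T) ->
  exists m : R, M = m%:M.
Proof.
move=> h.
have eL i j k l : (M *m delta_mx i j) k l = M k i * (l == j)%:R.
  rewrite mxE (bigD1 i) //= big1 ?addr0 ?mxE ?eqxx // => p pi.
  by rewrite !mxE (negPf pi) mulr0.
have eR i j k l : (delta_mx i j *m M^T) k l = M l j * (k == i)%:R.
  rewrite mxE (bigD1 j) //= big1 ?addr0 ?mxE ?eqxx ?andbT 1?mulrC // => p pj.
  by rewrite !mxE (negPf pj) andbF mul0r.
have off i j : i != j -> M i j = 0.
  move=> ij; have /matrixP /(_ i i) := h i j ij.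
  rewrite mulmxBr mulmxBl [LHS]mxE [RHS]mxE ![(- (_ *m _)) i i]mxE.
  by rewrite !eL !eR eqxx (negPf ij) !mulr0 !mulr1; lra.
have dia i j : M i i = M j j.
  have [->//|ij] := eqVneq i j; have /matrixP /(_ i j) := h i j ij.
  rewrite mulmxBr mulmxBl [LHS]mxE [RHS]mxE ![(- (_ *m _)) i j]mxE.
  by rewrite !eL !eR !eqxx (negPf ij) eq_sym (negPf ij) !mulr0 !mulr1; lra.
case: n M h eL eR off dia => [|n] M h eL eR off dia.
  by exists 0; apply/matrixP => -[].
exists (M 0 0); apply/matrixP => i j; rewrite mxE.
have [<-|ij] := eqVneq i j; first by rewrite mulr1n (dia i 0).
by rewrite mulr0n off.
Qed.

(** Shows that the skew matrices [Z P U - U P Z] with [Z] and [U] symmetric include nonzero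
    multiples of every [E_ij - E_ji] when the diagonal of [P] does not vanish. *)
Lemma skew_delta (R : realType) (n : nat) (P : 'M[R]_n) i j :
  symm P ->
  delta_mx i i *m P *m (delta_mx i j + delta_mx j i) -
    (delta_mx i j + delta_mx j i) *m P *m delta_mx i i =
  P i i *: (delta_mx i j - delta_mx j i).
Proof.
move=> sP.
have E a b c d :
    delta_mx a b *m P *m delta_mx c d = P b c *: (delta_mx a d : 'M[R]_n).
  apply/matrixP => k l; rewrite mxE (bigD1 c) //= big1 ?addr0.
    rewrite !mxE (bigD1 b) //= big1 ?addr0 => [|p pb].
      rewrite !mxE !eqxx andbT /=; case: (k == a) => /=.
        by rewrite ?mul1r ?mul0r ?mulr0.
      by rewrite ?mul1r ?mul0r ?mulr0.
    by rewrite !mxE (negPf pb) andbF mul0r.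
  by move=> p pc; rewrite !mxE (negPf pc) mulr0.
have Pij : P j i = P i j by rewrite -{1}(symm_tr sP) mxE.
by rewrite mulmxDr !mulmxDl !E Pij scalerBr opprD addrA addrK.
Qed.

(* Here [q] stands for H''(W) and [c] for D^3 H(W); the last hypothesis is the *)
(* derivative in [W] of [cone_aut_quad], taken at [X = W]. Substituting        *)
(* [A := W (q a) W], it expresses [e a v z + e a z v] by a symmetric form,     *)
(* where [e a v z = c (W (q a) W) (W (q v) W) z] is symmetric in [a] and [v].  *)
Lemma cone_aut_third_form (R : realType) (n : nat) (q : 'M[R]_n -> 'M[R]_n)
    (W : 'M[R]_n) (c : 'M[R]_n -> 'M[R]_n -> 'M[R]_n -> R) :
  cone_aut q -> posdef W ->
  (forall A B C, symm A -> symm B -> symm C -> c A B C = c B A C) ->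
  (forall A B C, symm A -> symm B -> symm C -> c A B C = c A C B) ->
  (forall A V Z, symm A -> symm V -> symm Z ->
     c A V (W *m q Z *m W) + c A Z (W *m q V *m W) =
     - 2 * (\tr (q A *m V *m q W *m Z) + \tr (q W *m V *m q A *m Z))) ->
  forall A B C, symm A -> symm B -> symm C ->
    c A B C = - (\tr (q A *m invmx (q W) *m q B *m C) +
                 \tr (q B *m invmx (q W) *m q A *m C)).
Proof.
move=> cq pW c12 c23 c_diff A B C sA sB sC.
have sq := cone_aut_symm cq; have sW := proj1 pW.
have pS : posdef (q W) by apply/(cone_aut_pos cq).
pose P B := W *m q B *m W.
have sP D : symm D -> symm (P D) by move=> sD; exact/symm_conj/sq.
have qP D : symm D -> q (P D) = q W *m D *m q W.
  by move=> sD; exact: cone_aut_quad.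
have P_surj D : symm D -> exists2 D', symm D' & P D' = D.
  move=> sD; have sJ := symm_inv sW.
  have [D' sD' qD'] := cone_aut_surj cq (symm_conj sJ sD).
  exists D' => //.
  rewrite /P qD' !mulmxA mulmxV ?mul1mx; last exact: posdef_unit.
  by rewrite -mulmxA mulVmx ?mulmx1 //; exact: posdef_unit.
have [a sa Pa] := P_surj A sA; have [b sb Pb] := P_surj B sB.
rewrite -Pa -Pb !qP //; set S := q W in pS *.
pose g x y z := \tr (S *m x *m S *m y *m S *m z).
have gC x y z : g x y z = g y z x.
  transitivity (\tr ((S *m x) *m (S *m y *m S *m z))).
    by rewrite /g !mulmxA.
  by rewrite mxtrace_mulC /g !mulmxA.
(* This is the last hypothesis at [A := P x], where [q (P x) = S x S]. *)
have E x y z : symm x -> symm y -> symm z ->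
    c (P x) (P y) z + c (P x) (P z) y = - 2 * (g x y z + g y x z).
  move=> sx sy sz; have := c_diff _ y z (sP _ sx) sy sz.
  rewrite -/(P y) -/(P z) (c23 (P x) y _ (sP _ sx) sy (sP _ sz)).
  rewrite (c23 (P x) z _ (sP _ sx) sz (sP _ sy)) addrC => ->.
  by rewrite qP // /g -/S !mulmxA.
have SRS x y : S *m x *m S *m invmx S *m (S *m y *m S) = S *m x *m S *m y *m S.
  rewrite !mulmxA -[_ *m invmx S *m S]mulmxA mulVmx ?mulmx1 //.
  exact: posdef_unit.
rewrite !SRS -/(g a b C) -/(g b a C).
(* As in Koszul's formula, [e1 + e2 - e3] leaves twice [c (P a) (P b) C]. The values of [g] fall
   into two classes under cyclic permutation, so the three right-hand sides coincide. *)
have e1 := E _ _ _ sa sb sC; have e2 := E _ _ _ sb sC sa.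
have e3 := E _ _ _ sC sa sb.
rewrite (c12 (P b) (P a) C (sP _ sb) (sP _ sa) sC) in e2.
rewrite (c12 (P C) (P a) b (sP _ sC) (sP _ sa) sb) in e3.
rewrite (c12 (P C) (P b) a (sP _ sC) (sP _ sb) sa) in e3.
have g1 := gC a b C; have g2 := gC b C a.
have g3 := gC b a C; have g4 := gC a C b.
move: e1 e2 e3; rewrite g1 g2 g3 g4; lra.
Qed.

(** The formula for [c] is symmetric in its first two arguments by inspection, whereas its symmetry
    under exchanging the first and the third is a genuine constraint. With [S = q W] and [P = S^-1]
    it yields [(S W) K = K (S W)^T] for enough skew [K] to make [S W] scalar. *)
Lemma cone_aut_third_form_scalar (R : realType) (n : nat)
    (q : 'M[R]_n -> 'M[R]_n) (W : 'M[R]_n)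
    (c : 'M[R]_n -> 'M[R]_n -> 'M[R]_n -> R) :
  cone_aut q -> posdef W ->
  (forall A B C, symm A -> symm B -> symm C -> c A B C = c B A C) ->
  (forall A B C, symm A -> symm B -> symm C -> c A B C = c A C B) ->
  (forall A B, symm A -> symm B -> c W A B = - 2 * trdot (q A) B) ->
  (forall A V Z, symm A -> symm V -> symm Z ->
     c A V (W *m q Z *m W) + c A Z (W *m q V *m W) =
     - 2 * (\tr (q A *m V *m q W *m Z) + \tr (q W *m V *m q A *m Z))) ->
  exists m : R, q W *m W = m%:M.
Proof.
move=> cq pW c12 c23 cW c_diff.
have cE := cone_aut_third_form cq pW c12 c23 c_diff.
have sq := cone_aut_symm cq; have sW := proj1 pW.
have pS : posdef (q W) by apply/(cone_aut_pos cq).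
set S := q W in pS cE *; pose P := invmx S.
have pP : posdef P by exact: posdef_inv.
have sP := proj1 pP; have uS := posdef_unit pS.
(* Evaluates [c A B W] twice, by the formula and by [cW]. The result expresses the inverse of [q]
   through [P] and [W]. *)
have qinv B : symm B -> 2 *: B = P *m q B *m W + W *m q B *m P.
  move=> sB; have sqB := sq _ sB.
  apply: trdot_inj; [exact: symmZ | exact: symm_anti|] => U sU.
  have [A sA qA] := cone_aut_surj cq sU.
  have := cE A B W sA sB sW; rewrite c23 // c12 // cW // qA -/P => e.
  rewrite trdotC trdotZr [RHS]trdotC trdotDr /trdot !mulmxA.
  rewrite [\tr (U *m W *m _ *m _)]mxtrace_mulC !mulmxA.
  rewrite [\tr (P *m U *m W *m _)]mxtrace_mulC !mulmxA.
  by move: e; rewrite /trdot; lra.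
(* With [U = q A] and [Z = q C], equate the formulas for [c A B C] and [c C B A], let [B] vary, and
   eliminate [A] and [C] by [qinv]. The terms with [W] in the middle cancel, and multiplying by [S]
   on both sides leaves this identity. *)
have key U Z : symm U -> symm Z ->
    S *m W *m (Z *m P *m U - U *m P *m Z) =
    (Z *m P *m U - U *m P *m Z) *m (S *m W)^T.
  move=> sU sZ.
  have [A sA qA] := cone_aut_surj cq sU; have [C sC qC] := cone_aut_surj cq sZ.
  have eA := qinv A sA; have eC := qinv C sC.
  rewrite qA in eA; rewrite qC in eC.
  have : (2 *: C) *m U *m P + P *m U *m (2 *: C) =
         (2 *: A) *m Z *m P + P *m Z *m (2 *: A).
    apply: trdot_inj; [apply: symm_anti => //; exact: symmZ..|] => V sV.
    have [B sB qB] := cone_aut_surj cq sV.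
    have := cE A B C sA sB sC; rewrite c12 // c23 // c12 // cE // qA qB qC -/P.
    have cyc (M1 M2 M3 M4 : 'M[R]_n) : \tr (M1 *m M2 *m M3 *m M4) =
        \tr (M2 *m M3 *m M4 *m M1).
      by rewrite -!mulmxA mxtrace_mulC !mulmxA.
    rewrite !trdotDl -!scalemxAl -!scalemxAr !trdotZl /trdot.
    rewrite (cyc Z P V A) (cyc P V A Z) (cyc V A Z P) (cyc V P Z A).
    rewrite (cyc U P V C) (cyc P V C U) (cyc V C U P) (cyc V P U C).
    lra.
  rewrite eA eC !(mulmxDl, mulmxDr) !mulmxA => e.
  have : W *m Z *m P *m U *m P + P *m U *m P *m Z *m W =
         W *m U *m P *m Z *m P + P *m Z *m P *m U *m W.
    move: e; set a1 := P *m Z *m W *m U *m P; set a2 := P *m U *m W *m Z *m P.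
    move: a1 a2 => a1 a2 /matrixP e; apply/matrixP => i j.
    have addE (M N : 'M[R]_n) : (M + N) i j = M i j + N i j by rewrite mxE.
    by have := e i j; rewrite !addE; lra.
  move=> {}e; have := congr1 (fun M => S *m M *m S) e.
  have PS : P *m S = 1%:M by rewrite mulVmx.
  have SP : S *m P = 1%:M by rewrite mulmxV.
  rewrite !(mulmxDl, mulmxDr) !mulmxA SP !mul1mx.
  rewrite -![_ *m P *m S]mulmxA PS !mulmx1.
  rewrite trmx_mul (symm_tr sW) (symm_tr (proj1 pS)).
  rewrite !(mulmxN, mulNmx) !mulmxA => {}e.
  apply/eqP; rewrite subr_eq addrAC.
  by rewrite [Z *m _ *m _ *m _ *m _ + _]addrC -e addrK.
apply: mul_delta_eq_scalar => i j ij.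
have Pii : P i i != 0 by rewrite gt_eqF // posdef_diag_gt0.
have sdd : symm (delta_mx i j + delta_mx j i : 'M[R]_n).
  by apply/symmP; rewrite linearD /= !trmx_delta addrC.
have sd : symm (delta_mx i i : 'M[R]_n) by apply/symmP; rewrite trmx_delta.
have := key _ _ sdd sd; rewrite skew_delta // -scalemxAr -scalemxAl.
by move/(scalerI Pii).
Qed.

(** * The Hessian of a self-scaled barrier *)

(** Normalised so that pairing with a symmetric matrix returns its [(i, j)] entry. *)
Definition symm_delta (R : realType) (n : nat) (i j : 'I_n) : 'M[R]_n :=
  2^-1 *: (delta_mx i j + delta_mx j i).

Lemma symm_symm_delta (R : realType) (n : nat) (i j : 'I_n) :
  symm (symm_delta R i j).
Proof.
by apply/symmZ/symmP; rewrite linearD /= !trmx_delta addrC.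
Qed.

Lemma trdot_delta (R : realType) (n : nat) (S : 'M[R]_n) i j :
  trdot S (delta_mx i j) = S j i.
Proof.
rewrite /trdot /mxtrace (bigD1 j) //= big1 => [|k kj]; last first.
  rewrite mxE big1 // => l _; rewrite mxE.
  by rewrite (negPf kj) andbF mulr0.
rewrite addr0 mxE (bigD1 i) //= big1 => [|k ki].
  by rewrite mxE !eqxx mulr1 addr0.
by rewrite mxE (negPf ki) mulr0.
Qed.

Lemma trdot_symm_delta (R : realType) (n : nat) (S : 'M[R]_n) i j :
  symm S -> trdot S (symm_delta R i j) = S i j.
Proof.
move=> sS; rewrite trdotZr trdotDr !trdot_delta.
by rewrite -{1}(symm_tr sS) mxE; field.
Qed.

(** Riesz representation on the symmetric matrices; the entries of the representing matrix are the
    values of [L] at the [symm_delta]. *)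
Lemma symm_form_repr (R : realType) (n : nat) (L : 'M[R]_n -> R) :
  (forall a b A B, symm A -> symm B ->
    L (a *: A + b *: B) = a * L A + b * L B) ->
  exists2 S, symm S & forall B, symm B -> L B = trdot S B.
Proof.
move=> linL; pose S := \matrix_(i, j) L (symm_delta R i j).
have sS : symm S.
  by apply/symmP/matrixP => i j; rewrite !mxE /symm_delta addrC.
exists S => // B sB.
have Lsum (I : Type) (r : seq I) (x : I -> R) (F : I -> 'M[R]_n) :
    (forall i, symm (F i)) ->
    symm (\sum_(i <- r) x i *: F i) /\
    L (\sum_(i <- r) x i *: F i) = \sum_(i <- r) x i * L (F i).
  move=> sF; elim: r => [|i r [sr IH]].
    rewrite !big_nil; split; first exact: symm0.
    have := linL 0 0 0 0 (symm0 R n) (symm0 R n).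
    by rewrite !scale0r addr0 !mul0r addr0.
  rewrite !big_cons; split; first by apply: symmD => //; exact: symmZ.
  by rewrite -[X in L (_ + X)]scale1r linL // mul1r IH.
have BE : B = \sum_(p : 'I_n * 'I_n) B p.1 p.2 *: symm_delta R p.1 p.2.
  rewrite -(pair_bigA _ (fun i j => B i j *: symm_delta R i j)) /=.
  transitivity (2^-1 *: (B + B^T)).
    rewrite (symm_tr sB) -{2 3}[B]scale1r -scalerDl scalerA.
    by have -> : 2^-1 * (1 + 1) = 1 :> R; [field | rewrite scale1r].
  have -> : B^T = \sum_i \sum_j B i j *: delta_mx j i.
    rewrite {1}(matrix_sum_delta B) linear_sum; apply: eq_bigr => i _ /=.
    rewrite linear_sum; apply: eq_bigr => j _ /=.
    by rewrite linearZ /= trmx_delta.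
  rewrite {1}(matrix_sum_delta B) -big_split scaler_sumr.
  apply: eq_bigr => i _ /=; rewrite -big_split scaler_sumr.
  apply: eq_bigr => j _ /=; rewrite -scalerDr.
  by rewrite /symm_delta !scalerA mulrC.
have [_ EL] := Lsum _ (index_enum _) (fun p : 'I_n * 'I_n => B p.1 p.2)
  (fun p => symm_delta R p.1 p.2) (fun p => symm_symm_delta R p.1 p.2).
have ET : trdot S B = \sum_(p : 'I_n * 'I_n) B p.1 p.2 * S p.1 p.2.
  rewrite {1}BE /trdot mulmx_sumr linear_sum /=; apply: eq_bigr => p _.
  by rewrite -/(trdot _ _) trdotZr trdot_symm_delta.
rewrite ET {1}BE EL; apply: eq_bigr => p _.
by rewrite mxE.
Qed.

Lemma dual_cone_psd (R : realType) (n : nat) (S : 'M[R]_n) :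
  dual_cone S -> psd S.
Proof.
move=> [sS dS]; split=> // u; apply/ler_addgt0Pr => e e0.
have d0 : 0 < `|\tr S| + 1 by rewrite ltr_wpDl.
have := dS _ (psd_perturb (psd_rank1 u) (posdef1 R n) (divr_gt0 e0 d0)).
rewrite trdotC trdotDr trdotZr trdot_rank1 /trdot mulmx1 => /ltW.
move=> /le_trans; apply; rewrite lerD2l mulrAC ler_pdivrMr // ler_pM2l //.
by apply: le_trans (ler_norm _) _; rewrite lerDl.
Qed.

(** The [get] in [hessian] meets its specification once a representing matrix exists. Linearity in
    [B] comes from Schwarz, which makes [B] the outer direction of differentiation. *)
Lemma hessianP (R : realType) (n : nat) (H : 'M[R]_n -> R) X A :
  class_C 3 H -> posdef X -> symm A -> symm (hessian H X A) /\
  forall B, symm B -> D2 H X A B = trdot (hessian H X A) B.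
Proof.
move=> cH pX sA; rewrite /hessian.
have [|S sS hS] := @symm_form_repr R n (fun B => D2 H X A B).
  move=> a b B C sB sC; have sBC := symmD (symmZ a sB) (symmZ b sC).
  have c1 : class_C 1 ('D_A H) by exact: class_CW (class_C_derive cH sA).
  have sch D : symm D -> 'D_A ('D_D H) X = 'D_D ('D_A H) X.
    by move=> sD; exact: class_C_schwarz (class_CW cH) pX sA sD.
  rewrite /D2 (sch _ sBC) (sch _ sB) (sch _ sC).
  exact: derive_linear_direction.
exact: (@getPex _ [set S | symm S /\
    forall B : 'M[R]_n, symm B -> D2 H X A B = trdot S B]
    (ex_intro _ S (conj sS hS))).
Qed.

Lemma D2_repr_linear (R : realType) (n : nat) (H : 'M[R]_n -> R) X a A B
    (SA SB SAB : 'M[R]_n) :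
  class_C 3 H -> posdef X -> symm A -> symm B ->
  symm SA -> symm SB -> symm SAB ->
  (forall C, symm C -> D2 H X A C = trdot SA C) ->
  (forall C, symm C -> D2 H X B C = trdot SB C) ->
  (forall C, symm C -> D2 H X (a *: A + B) C = trdot SAB C) ->
  SAB = a *: SA + SB.
Proof.
move=> cH pX sA sB s1 s2 s3 h1 h2 h3.
apply: trdot_inj => //; first by apply/symmD/s2/symmZ.
move=> C sC; rewrite trdotDl trdotZl -(h3 _ sC) -(h1 _ sC) -(h2 _ sC) /D2.
have c1 : class_C 1 ('D_C H) by exact: class_CW (class_C_derive cH sC).
by have := derive_linear_direction a 1 c1 pX sA sB; rewrite scale1r mul1r.
Qed.

Lemma hessian_linear (R : realType) (n : nat) (H : 'M[R]_n -> R) X a A B :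
  class_C 3 H -> posdef X -> symm A -> symm B ->
  hessian H X (a *: A + B) = a *: hessian H X A + hessian H X B.
Proof.
move=> cH pX sA sB; have sAB : symm (a *: A + B) by apply/symmD/sB/symmZ.
have [s1 h1] := hessianP cH pX sA; have [s2 h2] := hessianP cH pX sB.
have [s3 h3] := hessianP cH pX sAB.
exact: D2_repr_linear cH pX sA sB s1 s2 s3 h1 h2 h3.
Qed.

Lemma D2_sym (R : realType) (n : nat) (H : 'M[R]_n -> R) X A B :
  class_C 3 H -> posdef X -> symm A -> symm B -> D2 H X A B = D2 H X B A.
Proof.
by move=> cH pX sA sB; exact: class_C_schwarz (class_CW cH) pX sA sB.
Qed.

Lemma hessian_adj (R : realType) (n : nat) (H : 'M[R]_n -> R) X A B :
  class_C 3 H -> posdef X -> symm A -> symm B ->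
  trdot (hessian H X A) B = trdot A (hessian H X B).
Proof.
move=> cH pX sA sB; have [s1 h1] := hessianP cH pX sA.
have [s2 h2] := hessianP cH pX sB.
apply: etrans (esym (h1 _ sB)) _; apply: etrans (D2_sym cH pX sA sB) _.
by apply: etrans (h2 _ sA) _; exact: trdotC.
Qed.

(** The maximiser [Z] for [q X] is also a competitor in the maximum for [q Y], and (b) turns the
    comparison of the two conjugates into one of [H X] and [H Y]. *)
Lemma self_scaled_monotone (R : realType) (n : nat) (nu : R)
    (H : 'M[R]_n -> R) W X Y :
  self_scaled nu H -> posdef W -> posdef X -> posdef Y ->
  (forall Z, posdef Z ->
    trdot Z (hessian H W Y) <= trdot Z (hessian H W X)) -> H X <= H Y.
Proof.
move=> ss pW pX pY le.
have [[Z pZ EZ] _] := self_scaled_conjugate ss pX pW.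
have [_ ubY] := self_scaled_conjugate ss pY pW.
have aux (tX tY hX hY hZ hW : R) : - tX - hZ = hX - 2 * hW - nu ->
    - tY - hZ <= hY - 2 * hW - nu -> tY <= tX -> hX <= hY by lra.
exact: aux EZ (ubY _ (ex_intro2 _ _ Z pZ erefl)) (le Z pZ).
Qed.

Lemma psd_boundary (R : realType) (n : nat) (X : 'M[R]_n) :
  psd X -> ~ posdef X ->
  [/\ forall k, posdef (X + k.+1%:R^-1 *: 1%:M), cone_boundary X &
    X + k.+1%:R^-1 *: 1%:M @[k --> \oo] --> X].
Proof.
move=> pX npX.
have pk k : posdef (X + (k.+1%:R^-1 : R) *: 1%:M).
  by apply: psd_perturb => //; exact: posdef1.
have cX : X + (k.+1%:R^-1 : R) *: 1%:M @[k --> \oo] --> X.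
  rewrite -[X in _ --> X]addr0 -(scale0r (1%:M : 'M[R]_n)).
  apply: cvgD; first exact: cvg_cst.
  by apply: cvgZr_tmp; exact: cvg_harmonic.
split=> //; split=> // B /cX [N _ hN]; exists (X + (N.+1%:R^-1 : R) *: 1%:M).
by split; [exact: pk | apply: hN => /=].
Qed.

(** If [X] were on the boundary, [H] would blow up along [X + 1 / k]. But the images of these points
    dominate [q X], hence [e (q 1)] for a small [e], so monotonicity bounds [H] there by
    [H (e 1)]. *)
Lemma hessian_posdef_boundary (R : realType) (n : nat) (nu : R)
    (H : 'M[R]_n -> R) W X :
  self_scaled nu H -> posdef W -> psd X -> posdef (hessian H W X) -> posdef X.
Proof.
move=> ss pW pX pqX; apply: contrapT => npX.
have [bar dual _] := ss; have cH := barrier_C3 bar; have s1 := symm1 R n.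
have sX := proj1 pX.
have q_dual Y : posdef Y -> dual_cone (hessian H W Y) by move=> pY; exact: dual.
have q_linear a A B : symm A -> symm B ->
    hessian H W (a *: A + B) = a *: hessian H W A + hessian H W B.
  by move=> sA sB; exact: hessian_linear.
have q_mono Y Z := @self_scaled_monotone _ _ _ _ W Y Z ss pW.
move: (hessian H W) pqX q_dual q_linear q_mono => q pqX q_dual q_linear q_mono.
have dq1 : dual_cone (q 1%:M) by apply: q_dual; exact: posdef1.
have [e e0 he] := posdef_line pqX (symmZ (-1) (proj1 dq1)).
have pe : posdef (e *: 1%:M : 'M[R]_n) by apply: posdefZ => //; exact: posdef1.
have [pk bX cX] := psd_boundary pX npX.
have /cvgryPgt /(_ (H (e *: 1%:M))) [N _ /(_ N (leqnn _)) /=] :=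
  barrier_boundary bar pk bX cX.
apply/negP; rewrite -leNgt; apply: q_mono => // Z pZ.
have -> : q (e *: 1%:M) = e *: q 1%:M.
  have := q_linear e 1%:M 0 s1 (symm0 R n); rewrite addr0 => ->.
  have := q_linear 1 0 0 (symm0 R n) (symm0 R n).
  rewrite scale1r addr0 scale1r => /eqP.
  by rewrite -subr_eq subrr => /eqP <-; rewrite addr0.
rewrite [X + _]addrC q_linear // trdotDr -subr_ge0 -addrA -trdotBr addr_ge0 //.
  by rewrite trdotZr mulr_ge0 ?invr_ge0 // ltW //; apply: (proj2 dq1).
apply: trdot_psd_ge0; first exact: posdef_psd.
by rewrite -scaleNr -mulrN1 -scalerA; apply/posdef_psd/he; rewrite gtr0_norm.
Qed.

(** Move from [X] in the direction [1] until the cone is first met. The image of that entry point is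
    still positive definite, so by [hessian_posdef_boundary] the point is interior, which
    contradicts its being the first. *)
Lemma hessian_posdefE (R : realType) (n : nat) (nu : R)
    (H : 'M[R]_n -> R) W X :
  self_scaled nu H -> posdef W -> symm X -> posdef (hessian H W X) -> posdef X.
Proof.
move=> ss pW sX pqX; apply: contrapT => npX.
have [bar dual _] := ss; have cH := barrier_C3 bar; have s1 := symm1 R n.
have dq1 : dual_cone (hessian H W 1%:M) by apply: dual => //; exact: posdef1.
pose E := [set t : R | 0 <= t /\ posdef (X + t *: 1%:M)].
have E_lb : lbound E 0 by move=> t [].
have E0 : E !=set0.
  have [a a0 ha] := posdef_line (posdef1 R n) sX.
  exists a^-1; split; first by rewrite invr_ge0 ltW.
  have -> : X + a^-1 *: 1%:M = a^-1 *: (1%:M + a *: X).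
    by rewrite scalerDr scalerA mulVf ?gt_eqF // scale1r addrC.
  by apply: posdefZ; [rewrite invr_gt0 | apply: ha; rewrite gtr0_norm].
have iE : has_inf E by split=> //; exists 0.
have t0 : 0 <= inf E by apply: lb_le_inf.
have pt : psd (X + inf E *: 1%:M).
  apply: (psd_limit (P := 1%:M)) => [|e e0]; first by apply/symmD/symmZ.
  have [t [_ pXt] te] := inf_adherent e0 iE.
  have -> : X + inf E *: 1%:M + e *: 1%:M =
      X + t *: 1%:M + (inf E + e - t) *: 1%:M.
    by rewrite -!addrA -!scalerDl; congr (_ + _ *: _); ring.
  apply: posdefD => //; apply/psdZ/posdef_psd/posdef1.
  by rewrite subr_ge0 ltW.
have pqt : posdef (hessian H W (X + inf E *: 1%:M)).
  rewrite addrC hessian_linear // addrC.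
  by apply: posdefD => //; apply/psdZ/dual_cone_psd.
have pX := hessian_posdef_boundary ss pW pt pqt.
have [e e0 he] := posdef_line pX s1.
have [le_te|lt_et] := leP (inf E) e.
  apply: npX; have := he (- inf E); rewrite normrN ger0_norm // => /(_ le_te).
  by rewrite -addrA -scalerDl subrr scale0r addr0.
have : E (inf E - e).
  split; first by rewrite subr_ge0 ltW.
  have := he (- e); rewrite normrN gtr0_norm // => /(_ (lexx _)).
  by rewrite -addrA -scalerDl.
move=> /(inf_lbound (ex_intro _ 0 E_lb)); lra.
Qed.

Lemma hessian_cone_aut (R : realType) (n : nat) (nu : R)
    (H : 'M[R]_n -> R) W :
  self_scaled nu H -> posdef W -> cone_aut (hessian H W).
Proof.
move=> ss pW; have [bar dual _] := ss; have cH := barrier_C3 bar.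
have sq A : symm A -> symm (hessian H W A).
  by move=> sA; have [] := hessianP cH pW sA.
have surj B : symm B -> exists2 A, symm A & hessian H W A = B.
  move=> sB; have [_ _ /(_ B sB)] := barrier_nonsingular bar pW.
  by move=> [A sA AB]; exists A.
split=> //.
- by move=> a A B sA sB; exact: hessian_linear.
- by move=> A B sA sB; exact: hessian_adj.
move=> X sX; split=> [|pX]; first exact: hessian_posdefE ss pW sX.
split; first exact: sq.
have s1 := symm1 R n.
(* Condition (a) gives only a semidefinite image. Strictness follows by applying it to [X + e B]
   with [q B = - 1], so that [q X - e 1] is semidefinite. *)
have [B sB qB] := surj _ (symmZ (-1) s1) => u u0.
have [e e0 he] := posdef_line pX sB.
have peB : posdef (e *: B + X) by rewrite addrC; apply: he; rewrite gtr0_norm.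
have [_ /(_ u)] := dual_cone_psd (dual _ _ peB pW).
rewrite hessian_linear // qB qformD scalerA qformZ -/(qform _ u).
have := mulr_gt0 e0 (qform1_gt0 u0); lra.
Qed.

Lemma D3_sym12 (R : realType) (n : nat) (H : 'M[R]_n -> R) X A B C :
  class_C 3 H -> posdef X -> symm A -> symm B -> symm C ->
  D3 H X A B C = D3 H X B A C.
Proof.
move=> cH pX sA sB sC.
exact: class_C_schwarz (class_C_derive cH sC) pX sA sB.
Qed.

Lemma D3_sym23 (R : realType) (n : nat) (H : 'M[R]_n -> R) X A B C :
  class_C 3 H -> posdef X -> symm A -> symm B -> symm C ->
  D3 H X A B C = D3 H X A C B.
Proof.
move=> cH pX sA sB sC.
have c1 := class_C_derive (class_C_derive cH sC) sB.
have d1 := class_C_derivable c1 pX sA.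
have E Y : posdef Y -> 'D_B ('D_C H) Y = 'D_C ('D_B H) Y.
  by move=> pY; exact: class_C_schwarz (class_CW cH) pY sB sC.
exact: derive_posdef pX sA E d1.
Qed.

Lemma D3_repr (R : realType) (n : nat) (H : 'M[R]_n -> R) X A :
  class_C 3 H -> posdef X -> symm A ->
  exists T : 'M[R]_n -> 'M[R]_n, forall B, symm B -> symm (T B) /\
    forall C, symm C -> D3 H X A B C = trdot (T B) C.
Proof.
move=> cH pX sA.
suff h B : exists T : 'M[R]_n, symm B -> symm T /\
    forall C, symm C -> D3 H X A B C = trdot T C.
  by have [T hT] := choice h; exists T.
case: (pselect (symm B)) => [sB|nB]; last by exists 0.
have [|T sT hT] := @symm_form_repr R n (fun C => D3 H X A B C).
  move=> a b C D sC sD; have sCD := symmD (symmZ a sC) (symmZ b sD).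
  have E Y : symm Y -> D3 H X A B Y = D3 H X Y A B.
    move=> sY; apply: etrans (D3_sym23 cH pX sA sB sY) _.
    exact: D3_sym12 cH pX sA sY sB.
  have c1 := class_C_derive (class_C_derive cH sB) sA.
  apply: etrans (E _ sCD) _.
  apply: etrans (derive_linear_direction a b c1 pX sC sD) _.
  exact: esym (congr2 (fun x y => a * x + b * y) (E _ sC) (E _ sD)).
by exists T.
Qed.

(** * Entrywise derivatives of matrix-valued functions *)

Definition is_derive_mx (R : realType) (V : normedModType R) (m n : nat)
    (x v : V) (M : V -> 'M[R]_(m, n)) (dM : 'M[R]_(m, n)) : Prop :=
  forall i j, is_derive x v (fun y => M y i j) (dM i j).

Lemma is_derive_mx_cst (R : realType) (V : normedModType R) (m n : nat)
    (x v : V) (M : 'M[R]_(m, n)) : is_derive_mx x v (fun=> M) 0.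
Proof. by move=> i j; rewrite mxE; exact: is_derive_cst. Qed.

Lemma is_derive_mx_mul (R : realType) (V : normedModType R) (m n p : nat)
    (x v : V) (M : V -> 'M[R]_(m, n)) (N : V -> 'M[R]_(n, p)) dM dN :
  is_derive_mx x v M dM -> is_derive_mx x v N dN ->
  is_derive_mx x v (fun y => M y *m N y) (dM *m N x + M x *m dN).
Proof.
move=> hM hN i j.
have E : (fun y => (M y *m N y) i j) = \sum_k (fun y => M y i k * N y k j).
  by apply/funext => y; rewrite mxE fct_sumE.
rewrite E; apply: is_derive_eq.
  by apply: is_derive_sum => k; apply: is_deriveM.
rewrite !mxE -big_split /=; apply: eq_bigr => k _.
by rewrite addrC; congr (_ + _); exact: mulrC.
Qed.

Lemma is_derive_mx_mulr (R : realType) (V : normedModType R) (m n p : nat)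
    (x v : V) (M : V -> 'M[R]_(m, n)) (N : 'M[R]_(n, p)) dM :
  is_derive_mx x v M dM -> is_derive_mx x v (fun y => M y *m N) (dM *m N).
Proof.
move=> hM; have := is_derive_mx_mul hM (is_derive_mx_cst x v N).
by rewrite mulmx0 addr0.
Qed.

Lemma is_derive_mx_mull (R : realType) (V : normedModType R) (m n p : nat)
    (x v : V) (M : 'M[R]_(m, n)) (N : V -> 'M[R]_(n, p)) dN :
  is_derive_mx x v N dN -> is_derive_mx x v (fun y => M *m N y) (M *m dN).
Proof.
move=> hN; have := is_derive_mx_mul (is_derive_mx_cst x v M) hN.
by rewrite mul0mx add0r.
Qed.

Lemma is_derive_mxtrace (R : realType) (V : normedModType R) (n : nat)
    (x v : V) (M : V -> 'M[R]_n) dM :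
  is_derive_mx x v M dM -> is_derive x v (fun y => \tr (M y)) (\tr dM).
Proof.
move=> hM; have -> : (fun y => \tr (M y)) = \sum_k (fun y => M y k k).
  by apply/funext => y; rewrite fct_sumE.
by apply: is_derive_sum => k; exact: hM.
Qed.

Lemma is_derive_hessian (R : realType) (n : nat) (H : 'M[R]_n -> R)
    (W A B T : 'M[R]_n) :
  class_C 3 H -> posdef W -> symm A -> symm B -> symm T ->
  (forall C, symm C -> D3 H W A B C = trdot T C) ->
  is_derive_mx W A (fun Y => hessian H Y B) T.
Proof.
move=> cH pW sA sB sT hT i j; have sE := symm_symm_delta R i j.
apply: (@is_derive_posdef _ _ (fun Y => D2 H Y B (symm_delta R i j))) => //.
  move=> Y pY; have [sq hq] := hessianP cH pY sB.
  by apply: etrans (hq _ sE) _; exact: trdot_symm_delta.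
have c1 := class_C_derive (class_C_derive cH sE) sB.
have -> : T i j = D3 H W A B (symm_delta R i j).
  by apply: esym; apply: etrans (hT _ sE) _; exact: trdot_symm_delta.
exact: derivableP (class_C_derivable c1 pW sA).
Qed.

(** * Euler's relations from logarithmic homogeneity *)

Lemma grad_scaled (R : realType) (n : nat) (nu : R) (H : 'M[R]_n -> R) X A t :
  sc_log_homogeneous_barrier nu H -> posdef X -> symm A -> 0 < t ->
  'D_A H (t *: X) = t^-1 * 'D_A H X.
Proof.
move=> bar pX sA t0; have cH := barrier_C3 bar.
have c1 := class_CW (class_CW cH).
apply: etrans (@derive_scaled _ _ H X A t 1 (- (nu * ln t)) c1 t0 pX sA _) _.
  by move=> Y pY; rewrite mul1r (barrier_log_homogeneous bar).
by rewrite mul1r.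
Qed.

Lemma D2_scaled (R : realType) (n : nat) (nu : R) (H : 'M[R]_n -> R) X A B t :
  sc_log_homogeneous_barrier nu H -> posdef X -> symm A -> symm B -> 0 < t ->
  D2 H (t *: X) A B = t^-1 * (t^-1 * D2 H X A B).
Proof.
move=> bar pX sA sB t0; have cH := barrier_C3 bar.
have c1 := class_CW (class_C_derive cH sB).
apply: (@derive_scaled _ _ ('D_B H) X A t t^-1 0 c1 t0 pX sA).
by move=> Y pY; exact: etrans (grad_scaled bar pY sB t0) (esym (addr0 _)).
Qed.

Lemma is_derive_inv1 (R : realType) :
  is_derive (1 : R) (1 : R) (fun t : R => t^-1) (-1).
Proof.
have := is_deriveV (oner_neq0 R) (is_derive_id (1 : R) (1 : R)).
by rewrite expr1n invr1 scaleN1r.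
Qed.

Lemma euler_grad (R : realType) (n : nat) (nu : R) (H : 'M[R]_n -> R) X :
  sc_log_homogeneous_barrier nu H -> posdef X -> 'D_X H X = - nu.
Proof.
move=> bar pX; suff [] : is_derive X X H (- nu) by [].
apply: (@is_derive_radial _ _ H (fun t => H X - nu * ln t)) => [t t0|].
  by rewrite (barrier_log_homogeneous bar).
have := is_deriveB (is_derive_cst (H X) (1 : R) (1 : R))
  (is_deriveZ nu (is_derive1_ln (@ltr01 R))).
by rewrite sub0r invr1 scaler1.
Qed.

Lemma euler_D2 (R : realType) (n : nat) (nu : R) (H : 'M[R]_n -> R) X A :
  sc_log_homogeneous_barrier nu H -> posdef X -> symm A ->
  D2 H X X A = - 'D_A H X.
Proof.
move=> bar pX sA; suff [] : is_derive X X ('D_A H) (- 'D_A H X) by [].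
apply: (@is_derive_radial _ _ ('D_A H) (fun t => t^-1 * 'D_A H X)) => [t t0|].
  exact: (grad_scaled bar pX sA t0).
move: ('D_A H X) => c.
have := is_deriveM (is_derive_inv1 R) (is_derive_cst c (1 : R) (1 : R)).
by move=> d; apply: (is_derive_eq d); rewrite scaler0 add0r; exact: mulrN1.
Qed.

Lemma euler_D3 (R : realType) (n : nat) (nu : R) (H : 'M[R]_n -> R) X A B :
  sc_log_homogeneous_barrier nu H -> posdef X -> symm A -> symm B ->
  D3 H X X A B = - 2 * D2 H X A B.
Proof.
move=> bar pX sA sB.
suff [] : is_derive X X ('D_A ('D_B H)) (- 2 * D2 H X A B) by [].
apply: (@is_derive_radial _ _ ('D_A ('D_B H))
  (fun t => t^-1 * (t^-1 * D2 H X A B))) => [t t0|].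
  exact: (D2_scaled bar pX sA sB t0).
move: (D2 H X A B) => c.
have d := is_deriveM (is_derive_inv1 R) (is_derive_cst c (1 : R) (1 : R)).
apply: (is_derive_eq (is_deriveM (is_derive_inv1 R) d)).
transitivity (1^-1 * (1^-1 * 0 + c * -1) + 1^-1 * c * -1); first by [].
by rewrite invr1; ring.
Qed.

(** Pair [cone_aut_quad] for [hessian H Y] with [Z], keep the argument [W] of the quadratic map
    fixed, and differentiate in [Y] at [W] along [A]. By Euler's relation the derivative of
    [hessian H Y W] there is [- 2 (hessian H W A)]. *)
Lemma D3_cone_quad (R : realType) (n : nat) (nu : R) (H : 'M[R]_n -> R)
    (W A V Z : 'M[R]_n) :
  self_scaled nu H -> posdef W -> symm A -> symm V -> symm Z ->
  D3 H W A V (W *m hessian H W Z *m W) + D3 H W A Z (W *m hessian H W V *m W) =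
  - 2 * (\tr (hessian H W A *m V *m hessian H W W *m Z) +
         \tr (hessian H W W *m V *m hessian H W A *m Z)).
Proof.
move=> ss pW sA sV sZ; have bar := self_scaled_barrier ss.
have cH := barrier_C3 bar; have sW := proj1 pW.
have [T hT] := D3_repr cH pW sA.
have dT B : symm B -> is_derive_mx W A (fun Y => hessian H Y B) (T B).
  by move=> sB; have [sT hTB] := hT B sB; exact: is_derive_hessian.
have [sTV hTV] := hT V sV; have [sTZ hTZ] := hT Z sZ; have [sTW hTW] := hT W sW.
have [sq1 hq1] := hessianP cH pW sA.
have TWE : T W = (-2) *: hessian H W A.
  apply: trdot_inj => //; first exact: symmZ.
  move=> C sC; apply: etrans (esym (hTW C sC)) _.
  apply: etrans (D3_sym12 cH pW sA sW sC) _.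
  apply: etrans (euler_D3 bar pW sA sC) _.
  by rewrite trdotZl; congr (_ * _); exact: hq1.
have quad Y : posdef Y ->
    \tr (hessian H Y W *m V *m hessian H Y W *m Z) =
    \tr (W *m hessian H Y V *m W *m hessian H Y Z).
  move=> pY; have cq := hessian_cone_aut ss pY.
  have [sqV _] := hessianP cH pY sV.
  rewrite -(cone_aut_quad cq pW sV).
  exact: (cone_aut_adj cq (symm_conj sW sqV) sZ).
have d1 := is_derive_mxtrace (is_derive_mx_mulr Z
  (is_derive_mx_mul (is_derive_mx_mulr V (dT W sW)) (dT W sW))).
have d2 := is_derive_mxtrace (is_derive_mx_mul
  (is_derive_mx_mulr W (is_derive_mx_mull W (dT V sV))) (dT Z sZ)).
have [_ e1] := is_derive_posdef pW sA quad d1; have [_ e2] := d2.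
have sqV : symm (hessian H W V) by have [] := hessianP cH pW sV.
have sqZ : symm (hessian H W Z) by have [] := hessianP cH pW sZ.
have h1 := hTV _ (symm_conj sW sqZ); have h2 := hTZ _ (symm_conj sW sqV).
rewrite h1 h2; move: e1; rewrite e2 {}TWE => e1.
move: (hessian H W A) (hessian H W V) (hessian H W Z) (hessian H W W) e1
  => qA qV qZ S.
rewrite mulmxDl !linearD /= -!scalemxAl -!scalemxAr -!scalemxAl !linearZ /=.
rewrite -mulrDr => <-; congr (_ + _); last by rewrite trdotC /trdot.
rewrite /trdot !mulmxA [RHS]mxtrace_mulC !mulmxA.
by rewrite [RHS]mxtrace_mulC !mulmxA [RHS]mxtrace_mulC !mulmxA.
Qed.

Lemma grad_scalar (R : realType) (n : nat) (nu : R) (H : 'M[R]_n -> R) W :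
  (1 <= n)%N -> self_scaled nu H -> posdef W ->
  forall A, symm A -> 'D_A H W = - (nu / n%:R) * trdot (invmx W) A.
Proof.
move=> n1 ss pW A sA; have bar := self_scaled_barrier ss.
have cH := barrier_C3 bar; have cq := hessian_cone_aut ss pW.
have sW := proj1 pW.
have [sS hS] := hessianP cH pW sW.
have gradE B : symm B -> 'D_B H W = - trdot (hessian H W W) B.
  move=> sB; apply: oppr_inj; rewrite opprK.
  by apply: etrans (esym (euler_D2 bar pW sB)) _; exact: hS.
have [m Em] := cone_aut_third_form_scalar (c := D3 H W) cq pW
  (fun A B C sA sB sC => D3_sym12 cH pW sA sB sC)
  (fun A B C sA sB sC => D3_sym23 cH pW sA sB sC)
  (fun A B sA sB => etrans (euler_D3 bar pW sA sB)
     (congr1 (fun x => -2 * x) (proj2 (hessianP cH pW sA) B sB)))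
  (fun A V Z sA sV sZ => D3_cone_quad ss pW sA sV sZ).
(* The trace of [S W = m 1] is [n m], and Euler's relation gives [<S, W> = nu]. *)
have mE : m = nu / n%:R.
  have := gradE W sW; rewrite (euler_grad bar pW) /trdot Em mxtrace_scalar.
  move=> /oppr_inj ->; rewrite -[m *+ n]mulr_natr mulfK //.
  by rewrite pnatr_eq0 -lt0n.
have SE : hessian H W W = m *: invmx W.
  rewrite -[LHS]mulmx1 -(mulmxV (posdef_unit pW)) mulmxA Em.
  by rewrite mul_scalar_mx.
by rewrite gradE // SE mE trdotZl mulNr.
Qed.

(** Euler's relations give [nu = <hessian H 1 1, 1>], which is positive by (a). *)
Lemma barrier_param_gt0 (R : realType) (n : nat) (nu : R) (H : 'M[R]_n -> R) :
  self_scaled nu H -> 0 < nu.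
Proof.
move=> ss; have bar := self_scaled_barrier ss; have cH := barrier_C3 bar.
have p1 := posdef1 R n; have [s1 d1] := self_scaled_dual ss p1 p1.
have := d1 _ p1; have [_ h1] := hessianP cH p1 (symm1 R n).
rewrite trdotC; move: (h1 _ (symm1 R n)) => <-.
by rewrite (euler_D2 bar p1 (symm1 R n)) (euler_grad bar p1) opprK.
Qed.

(** * The gradient of the logarithm of the determinant *)

(* The coefficients of [det (1 + t B)] are those of the characteristic         *)
(* polynomial of [- B] in reverse order.                                       *)
Lemma det_line_poly (R : realType) (n : nat) (B : 'M[R]_n) :
  (0 < n)%N -> exists r : {poly R},
  (forall t, \det (1%:M + t *: B) = r.[t]) /\ r^`().[0] = \tr B.
Proof.
move=> n0; pose p := char_poly (- B).
have pn : p`_n = 1.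
  by have /monicP := char_poly_monic (- B); rewrite lead_coefE size_char_poly.
(* Reversal puts the leading coefficient 1 of [p] in degree 0, and its coefficient of degree
   [n - 1], which is [\tr B], in degree 1. *)
pose r := \poly_(i < n.+1) p`_(n - i).
exists r; split=> [t|]; last first.
  rewrite horner_coef0 coef_deriv mulr1n coef_poly ltnS n0 subn1.
  by rewrite char_poly_trace // linearN /= opprK.
have [->|t0] := eqVneq t 0.
  by rewrite scale0r addr0 det1 horner_coef0 coef_poly /= subn0 pn.
have hp s : p.[s] = \det (s%:M + B).
  rewrite /p /char_poly -horner_evalE -det_map_mx; congr (\det _).
  apply/matrixP => i j; rewrite !mxE /= /horner_eval.
  by rewrite hornerD hornerN hornerC hornerMn hornerX opprK.
have -> : 1%:M + t *: B = t *: (t^-1%:M + B).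
  by rewrite scalerDr scale_scalar_mx mulfV.
rewrite detZ -hp horner_poly (horner_coef_wide (n := n.+1)); last first.
  by rewrite size_char_poly.
rewrite mulr_sumr [RHS](reindex_inj rev_ord_inj) /=.
apply: eq_bigr => i _; have le_in : (i <= n)%N by rewrite -ltnS.
rewrite subSS subKn // mulrCA exprVn; congr (_ * _).
by rewrite expfB_cond // (negPf t0).
Qed.

Lemma posdef_segment (R : realType) (n : nat) (X : 'M[R]_n) (t : R) :
  posdef X -> 0 <= t -> t <= 1 -> posdef (1%:M + t *: (X - 1%:M)).
Proof.
move=> pX t0 t1; have -> : 1%:M + t *: (X - 1%:M) = (1 - t) *: 1%:M + t *: X.
  by rewrite scalerBr scalerBl scale1r addrCA addrC.
have [->|nt0] := eqVneq t 0.
  by rewrite subr0 scale1r scale0r addr0; exact: posdef1.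
rewrite addrC; apply: posdefD; first by apply: posdefZ; rewrite // lt0r nt0.
by apply: psdZ; [rewrite subr_ge0 | exact/posdef_psd/posdef1].
Qed.

(** Along the segment from [1] to [X] the determinant is a polynomial equal to 1 at the start and
    without zeros, so it keeps its sign. *)
Lemma posdef_det_gt0 (R : realType) (n : nat) (X : 'M[R]_n) :
  (0 < n)%N -> posdef X -> 0 < \det X.
Proof.
move=> n0 pX; have [r [hr _]] := det_line_poly (X - 1%:M) n0.
have r0 : r.[0] = 1 by rewrite -hr scale0r addr0 det1.
have r1 : r.[1] = \det X by rewrite -hr scale1r addrC subrK.
rewrite ltNge; apply/negP => dX.
have [|t /andP[t0 t1]] := @poly_ivt R (- r) 0 1 ler01.
  by rewrite !hornerN r0 r1 oppr_ge0 dX andbT lerN10.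
rewrite /root hornerN oppr_eq0 -hr.
have := posdef_unit (posdef_segment pX t0 t1).
by rewrite unitmxE unitfE => /negPf ->.
Qed.

(** Factoring [det (X + t A)] as [det X] times [det (1 + t X^-1 A)] reduces the claim to the linear
    coefficient found in [det_line_poly]. *)
Lemma is_derive_ln_det (R : realType) (n : nat) (X A : 'M[R]_n) :
  (0 < n)%N -> posdef X ->
  is_derive X A (fun Y => ln (\det Y)) (trdot (invmx X) A).
Proof.
move=> n0 pX; have [r [hr dr]] := det_line_poly (invmx X *m A) n0.
have dX := posdef_det_gt0 n0 pX; have uX := posdef_unit pX.
have r0 : r.[0] = 1 by rewrite -hr scale0r addr0 det1.
have E t : \det (X + t *: A) = \det X * r.[t].
  rewrite -hr -det_mulmx mulmxDr mulmx1 -scalemxAr mulmxA mulmxV //.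
  by rewrite mul1mx.
have d1 : is_derive (0 : R) (1 : R) (fun t => \det X * r.[t])
    (\det X * trdot (invmx X) A).
  rewrite /trdot -dr.
  exact: (is_deriveZ (\det X) (is_derive_poly r 0)).
have p0 : 0 < \det X * r.[0] by rewrite r0 mulr1.
have := @is_derive1_comp R (@ln R) (fun t => \det X * r.[t]) 0 _ _
  (is_derive1_ln p0) d1.
rewrite r0 mulr1 mulKf ?gt_eqF // => /is_derive_cvgP h; apply/is_derive_cvgP.
suff -> : (fun h => h^-1 * (ln (\det (X + h *: A)) - ln (\det X))) =
  (fun h => h^-1 * ((@ln R \o (fun t => \det X * r.[t])) (0 + h *: 1) -
                 (@ln R \o (fun t => \det X * r.[t])) 0)) by [].
apply/funext => t /=; rewrite E add0r [t *: 1]mulr1 r0 mulr1.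
by [].
Qed.

Theorem theorem8 (R : realType) (n : nat) (n_ge1 : (1 <= n)%N)
    (H : 'M[R]_n -> R) (H_self_scaled : self_scaled_barrier_functional H) :
  exists c1 c0 : R, 0 < c1 /\
    forall X : 'M[R]_n, posdef X -> H X = c0 - c1 * ln (\det X).
Proof.
have [nu ss] := H_self_scaled.
have cH := barrier_C3 (self_scaled_barrier ss).
pose c := nu / n%:R; exists c, (H 1%:M); split.
  by rewrite divr_gt0 ?ltr0n //; exact: barrier_param_gt0 ss.
(* All directional derivatives of [F] vanish on the cone, so the mean value theorem on the segment
   from [1] to [X] gives [F X = F 1 = H 1]. *)
move=> X pX; pose F Y := H Y + c * ln (\det Y).
have dF Y A : posdef Y -> symm A -> is_derive Y A F 0.
  move=> pY sA; have dH := derivableP (class_C_derivable cH pY sA).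
  have gE := grad_scalar n_ge1 ss pY sA.
  apply: (is_derive_eq (is_deriveD dH
    (is_deriveZ c (is_derive_ln_det A n_ge1 pY)))).
  by rewrite gE mulNr; exact: addNr.
have FE Y : F Y = H Y + c * ln (\det Y) by [].
move: F dF FE => F dF FE.
have sX := proj1 pX; have s1 := symm1 R n; have sD := symmB sX s1.
have dG (t : R) : t \in `[0, 1]%R ->
    is_derive t 1 (fun t : R => F (1%:M + t *: (X - 1%:M))) 0.
  rewrite in_itv /= => /andP[t0 t1]; apply: is_derive_affine.
  by apply: dF => //; exact: posdef_segment.
have dG_oo (s : R) : s \in `]0, 1[%R ->
    is_derive s 1 (fun t : R => F (1%:M + t *: (X - 1%:M))) 0.
  by move=> /subset_itv_oo_cc; exact: dG.
have [|s _] := @MVT_segment R _ (fun=> 0) 0 1 ler01 dG_oo.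
  by apply: derivable_within_continuous => s /dG [].
rewrite mul0r scale1r scale0r addr0 addrC [1%:M + _]addrC subrK !FE det1 ln1.
move: (H X) (H 1%:M) (ln _) => a b l.
lra.
Qed.
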